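(* Let $\kappa\in\mathcal{S}_{-1}$ be a Sonine kernel. For any $\lambda\in\mathbb{C}$, the element $l_{\kappa,\lambda}\in\mathcal{R}_{-1}\subset\mathcal{F}_{-1}$ defined by the convolution series $$l_{\kappa,\lambda}(t)=\sum_{j=1}^{+\infty}\lambda^{j-1}\kappa^j(t),\quad t>0,$$ is inverse to the element $(S_\kappa-\lambda)\in\mathcal{F}_{-1}$ with respect to multiplication, i.e. the following operational relation holds true in $\mathcal{F}_{-1}$: $$\frac{I}{S_\kappa-\lambda}=l_{\kappa,\lambda}.$$
   Context: Functions are complex-valued. $C_{-1}(0,+\infty)$ is the space of functions $f$ on $(0,+\infty)$ of the form $f(t)=t^{p-1}f_1(t)$, $t>0$, for some $p>0$ and some $f_1\in C[0,+\infty)$. $C_{-1,0}(0,+\infty)$ is the set of functions of the form $f(t)=t^{p-1}f_1(t)$, $t>0$, with some $0<p<1$ and $f_1\in C[0,+\infty)$. $(f*g)(t)=\int_0^t f(\tau)g(t-\tau)\,d\tau$ is the Laplace convolution, and $\kappa^j=\kappa*\cdots*\kappa$ ($j$ factors). $\mathcal{R}_{-1}=(C_{-1}(0,+\infty),+,* )$ is a commutative ring without divisors of zero (and without unity). $\mathcal{S}_{-1}$ is the set of functions $\kappa\in C_{-1,0}(0,+\infty)$ for which there is $k\in C_{-1,0}(0,+\infty)$ with $(\kappa*k)(t)=1$ for all $t>0$. The series defining $l_{\kappa,\lambda}$ converges for all $t>0$ and defines a function in $C_{-1}(0,+\infty)$. $\mathcal{F}_{-1}$ is the field of fractions (field of convolution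 quotients) of $\mathcal{R}_{-1}$: its elements are classes $\frac{f}{g}$ of pairs $(f,g)$, $f,g\in C_{-1}(0,+\infty)$, $g\not\equiv0$, under $(f_1,g_1)\sim(f_2,g_2)\Leftrightarrow f_1*g_2=f_2*g_1$, with $\frac{f_1}{g_1}+\frac{f_2}{g_2}=\frac{f_1*g_2+f_2*g_1}{g_1*g_2}$, $\frac{f_1}{g_1}\cdot\frac{f_2}{g_2}=\frac{f_1*f_2}{g_1*g_2}$, and scalar multiplication $\lambda\frac{f}{g}=\frac{\lambda f}{g}$. The ring $\mathcal{R}_{-1}$ is embedded in $\mathcal{F}_{-1}$ by $f\mapsto\frac{f*\kappa}{\kappa}$. $I=\frac{\kappa}{\kappa}$ is the unity of $\mathcal{F}_{-1}$, $\frac{I}{e}$ denotes the multiplicative inverse of $e\in\mathcal{F}_{-1}$, $S_\kappa:=\frac{\kappa}{\kappa^2}=\frac{I}{\kappa}$, and $S_\kappa-\lambda$ means $S_\kappa-\lambda I$ with $\lambda$ acting as a scalar. *)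

(* Defs.v *)
From HB Require Import structures.
From mathcomp Require Import all_boot all_order all_algebra.
From mathcomp Require Import all_classical all_reals all_analysis.
From mathcomp Require Import complex.
Set Implicit Arguments.
Unset Strict Implicit.
Unset Printing Implicit Defensive.
Import Order.TTheory GRing.Theory Num.Theory.
Import numFieldNormedType.Exports.
Local Open Scope classical_set_scope.
Local Open Scope ring_scope.
Local Open Scope complex_scope.

(* A function on (0, +oo) is a function on R whose values outside (0, +oo)
   are irrelevant.  R[i]^o is R[i] with the topology of the complex modulus. *)
Definition cfun (R : realType) : Type := R -> R[i]^o.

Section FunctionSpaces.
Variable R : realType.

Definition eq_pos (f g : cfun R) : Prop := forall t : R, 0 < t -> f t = g t.

Definition powerlike (p : R) (f : cfun R) : Prop :=
  exists2 f1 : cfun R, {within `[0, +oo[, continuous f1} &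
    eq_pos f (fun t => (t `^ (p - 1))%:C * f1 t).

Definition Cm1 (f : cfun R) : Prop :=
  exists2 p : R, 0 < p & powerlike p f.

Definition Cm10 (f : cfun R) : Prop :=
  exists2 p : R, 0 < p < 1 & powerlike p f.

(* Integral of a complex-valued function, by real and imaginary parts. *)
Definition cintegral (A : set R) (f : cfun R) : R[i]^o :=
  (\int[lebesgue_measure]_(x in A) complex.Re (f x))
  +i* (\int[lebesgue_measure]_(x in A) complex.Im (f x)).

Definition conv (f g : cfun R) : cfun R :=
  fun t => cintegral `]0, t[ (fun tau => f tau * g (t - tau)).

(* Meaningful for j >= 1 only, since the ring has no unity. *)
Definition convpow (f : cfun R) (j : nat) : cfun R := iter j.-1 (conv f) f.

Definition sonine (kappa : cfun R) : Prop :=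
  Cm10 kappa /\
  exists2 k : cfun R, Cm10 k & eq_pos (conv kappa k) (fun=> 1).

Definition lpartial (kappa : cfun R) (lambda : R[i]) (t : R) : nat -> R[i]^o :=
  fun n => \sum_(1 <= j < n) lambda ^+ j.-1 * convpow kappa j t.

Definition lser (kappa : cfun R) (lambda : R[i]) : cfun R :=
  fun t => limn (lpartial kappa lambda t).

End FunctionSpaces.

Section ConvolutionQuotients.
Variable R : realType.

(* A pair (f, g) representing the quotient f / g.  The operations on quotients
   are computed on representatives; they are compatible with frac_equiv because
   convolution on C_{-1} has no zero divisors. *)
Definition frac : Type := (cfun R * cfun R)%type.

Definition is_frac (p : frac) : Prop :=
  [/\ Cm1 p.1, Cm1 p.2 & ~ eq_pos p.2 (fun=> 0)].

Definition frac_equiv (p q : frac) : Prop :=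
  eq_pos (conv p.1 q.2) (conv q.1 p.2).

(* The element of the field of fractions represented by p; the field is the
   set of the classes quot p for p such that is_frac p. *)
Definition quot (p : frac) : set frac :=
  [set q | is_frac q /\ frac_equiv p q].

Definition frac_add (p q : frac) : frac :=
  (fun t => conv p.1 q.2 t + conv q.1 p.2 t, conv p.2 q.2).

Definition frac_mul (p q : frac) : frac := (conv p.1 q.1, conv p.2 q.2).

Definition frac_scale (lambda : R[i]) (p : frac) : frac :=
  (fun t => lambda * p.1 t, p.2).

Definition frac_sub (p q : frac) : frac := frac_add p (frac_scale (- 1) q).

Definition frac_inv (p : frac) : frac := (p.2, p.1).

Definition frac_embed (kappa f : cfun R) : frac := (conv f kappa, kappa).

Definition frac_one (kappa : cfun R) : frac := (kappa, kappa).

Definition frac_S (kappa : cfun R) : frac := (kappa, convpow kappa 2).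

End ConvolutionQuotients.

(* Main.v *)
Require Import Defs.
From mathcomp Require Import all_boot all_order all_algebra.
From mathcomp Require Import all_classical all_reals all_analysis.
From mathcomp Require Import complex.
From mathcomp Require Import measurable_realfun ring lra.
(* The libraries above hide the names conv and frac of Defs. *)
Import Defs.
Set Implicit Arguments.
Unset Strict Implicit.
Unset Printing Implicit Defensive.
Import Order.TTheory GRing.Theory Num.Theory.
Import numFieldNormedType.Exports.
Local Open Scope classical_set_scope.
Local Open Scope ring_scope.
Local Open Scope complex_scope.

(* Write f(t) = t^(p-1) u(t) with one exponent 0 < p <= 1 for all the functions
   at hand.  After the substitution tau = t s, convolution becomes, up to the
   factor t^(p-1), the bilinear operator
     (u, v) |-> t^p int_0^1 (s (1 - s))^(p-1) u(t s) v(t (1 - s)) ds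
   on continuous functions.  Applied to |v(t)| <= B t^(p n) it gains a factor
   t^p beta_n, where beta_n = int_0^1 (s (1 - s))^(p-1) (1 - s)^(p n) ds tends
   to 0, so the series of l converges normally on bounded sets by the ratio
   test, and l = kappa + lambda kappa * l.
   The equality of quotients then needs no theorem of Titchmarsh: kappa is
   cancellable because k * kappa = 1 and because 1 * h = 0 forces h = 0 (take
   derivatives), and the numerator e1 = kappa^2 - lambda kappa^3 of
   S_kappa - lambda is cancellable because e1 * l = kappa^3. *)

(** * Changes of variables and the weight (s (1 - s))^(p-1) *)

(** Cancellation enters because [quot] is a set of pairs: equality of two such classes is
    transitivity of [frac_equiv], and transitivity asks only that the denominator of the middle pair
    be cancelled. The denominators that occur are powers of kappa and, for the inverse, the
    numerator of S_kappa - lambda, so a direct argument for each replaces a statement about the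
    whole ring. Integrals are real, so a complex function is handled as a pair of real ones.
    Convolution with lambda kappa mixes the two components, and the iteration runs on coupled pairs
    with a common majorant. The exponent stays in ]0, 1]: constants then have the common form as
    well, and t^(p-1) is nonincreasing, which is what makes the weight integrable by comparison with
    its two end singularities. *)

Section ChangeOfVariables.
Variable R : realType.
Local Notation mu := (@lebesgue_measure R).
Local Open Scope ereal_scope.

Lemma measurable_affine (a c : R) : measurable_fun [set: R] (fun x : R => a + c * x)%R.
Proof. by apply: measurable_funD => //; exact: measurable_funM. Qed.

(** Uniqueness of Lebesgue measure: c times the image measure under x -> a + c x agrees with [mu] on
    half-open intervals. *)
Lemma lebesgue_measure_affine (a c : R) (A : set R) : (0 < c)%R -> measurable A ->
  mu ((fun x : R => a + c * x)%R @^-1` A) = (c^-1)%:E * mu A.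
Proof.
move=> c0 mA.
have c1 : (0 <= c)%R by exact: ltW.
pose phi : R -> measurableTypeR R := fun x => (a + c * x)%R.
have mphi : measurable_fun [set: measurableTypeR R] phi := measurable_affine a c.
pose nu : {measure set (measurableTypeR R) -> \bar R} :=
  mscale (NngNum c1) (pushforward mu phi).
have -> : mu A = nu mphi A.
  apply: (@lebesgue_measure_unique _ (nu mphi)) => // _ [[x y]] _ <-.
  change (mu `]x, y] = c%:E * mu (phi @^-1` `]x, y])).
  have -> : phi @^-1` `]x, y] = `]((x - a) / c)%R, ((y - a) / c)%R]%classic.
    apply/seteqP; split => z /=; rewrite !in_itv/= /phi ltr_pdivrMr // ler_pdivlMr //; lra.
  rewrite !lebesgue_measure_itv/= !lte_fin ltr_pM2r ?invr_gt0// ltrD2r.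
  case: ifPn => xy; last by rewrite mule0.
  by rewrite -!EFinB -EFinM; congr EFin; field; rewrite gt_eqF.
by rewrite /mscale/= muleA -EFinM mulVf ?gt_eqF// mul1e.
Qed.

Lemma ge0_integral_affine (a c : R) (f : R -> \bar R) : (0 < c)%R ->
  measurable_fun setT f -> (forall x, 0 <= f x) ->
  \int[mu]_x f (a + c * x)%R = (c^-1)%:E * \int[mu]_x f x.
Proof.
move=> c0 mf f0.
have ci0 : (0 <= c^-1)%R by rewrite invr_ge0 ltW.
have := @ge0_integral_pushforward _ _ (measurableTypeR R) (measurableTypeR R) R _
  (measurable_affine a c) mu setT f measurableT mf (fun x _ => f0 x).
rewrite preimage_setT => <-.
rewrite -(@ge0_integral_mscale _ _ _ mu _ measurableT (NngNum ci0))//.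
apply: eq_measure_integral => [|? A mA _]; first exact: measurable_affine.
exact: lebesgue_measure_affine.
Qed.

Lemma integral_affine (a c : R) (f : R -> \bar R) : (0 < c)%R ->
  measurable_fun setT f ->
  \int[mu]_x f (a + c * x)%R = (c^-1)%:E * \int[mu]_x f x.
Proof.
move=> c0 mf; rewrite [in RHS]integralE.
have ci0 : (0 < c^-1)%R by rewrite invr_gt0.
have -> : \int[mu]_x f (a + c * x)%R =
    \int[mu]_x f^\+ (a + c * x)%R - \int[mu]_x f^\- (a + c * x)%R.
  by rewrite integralE; congr (_ - _); apply: eq_integral => x _; rewrite ?funeposE ?funenegE.
rewrite !ge0_integral_affine//; [|exact: measurable_funeneg|exact: measurable_funepos].
(* Either part may be infinite, so c^-1 is distributed over the difference case by case;
   nonnegativity of both integrals excludes the value -oo. *)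
have := @integral_ge0 _ _ _ mu setT f^\+ (fun x _ => funepos_ge0 f x).
have := @integral_ge0 _ _ _ mu setT f^\- (fun x _ => funeneg_ge0 f x).
case: (\int[mu]_x f^\+ x) => [x| |]//; case: (\int[mu]_x f^\- x) => [y| |]// _ _;
  rewrite ?gt0_muley ?gt0_muleNy ?lte_fin//=.
by apply: (congr1 EFin); rewrite mulrBr.
Qed.

(** [integral_affine] covers positive slopes; invariance of Lebesgue measure under negation supplies
    the sign, and a translation by a gives the reflection. *)
Lemma integral_reflect (a : R) (f : R -> \bar R) : measurable_fun setT f ->
  \int[mu]_x f (a - x)%R = \int[mu]_x f x.
Proof.
have refl0 (g : R -> \bar R) : measurable_fun setT g -> (forall x, 0 <= g x) ->
    \int[mu]_x g (- x)%R = \int[mu]_x g x.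
  move=> mg g0.
  have := @ge0_integral_pushforward _ _ (measurableTypeR R) (measurableTypeR R) R _
    (@oppr_measurable R setT) mu setT g measurableT mg (fun x _ => g0 x).
  rewrite preimage_setT => <-.
  apply: eq_measure_integral => A mA _.
  exact: lebesgue_measureN.
have reflN (g : R -> \bar R) : measurable_fun setT g ->
    \int[mu]_x g (- x)%R = \int[mu]_x g x.
  move=> mg; rewrite [LHS]integralE [RHS]integralE; congr (_ - _).
    rewrite -[RHS]refl0//; last exact: measurable_funepos.
    by apply: eq_integral => x _; rewrite !funeposE.
  rewrite -[RHS]refl0//; last exact: measurable_funeneg.
  by apply: eq_integral => x _; rewrite !funenegE.
move=> mf.
have := @integral_affine a 1%R f lte01 mf.
rewrite invr1 mul1e => <-.
rewrite -[RHS](reflN (fun x => f (a + 1 * x)%R)); last first.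
  apply: measurableT_comp => //; exact: measurable_affine.
by apply: eq_integral => x _; rewrite mul1r.
Qed.

End ChangeOfVariables.

Section IntervalChangeOfVariables.
Variable R : realType.
Local Notation mu := (@lebesgue_measure R).

(** The values are extended reals so that [integrable_scale] can apply it to the absolute value of F
    before finiteness is known. *)
Lemma integral_scale (t : R) (F : R -> \bar R) : 0 < t ->
  measurable_fun `]0, t[ F ->
  (\int[mu]_(s in `]0%R, t[) F s = t%:E * \int[mu]_(s in `]0%R, 1%R[) F (t * s)%R)%E.
Proof.
move=> t0 mF; rewrite integral_mkcond [in RHS]integral_mkcond.
have mF' : measurable_fun setT (F \_ `]0, t[).
  by apply/(measurable_restrictT F).
have := integral_affine 0 t0 mF'.
have -> : (fun s => (F \_ `]0, t[) (0 + t * s)) = (fun s => F (t * s)) \_ `]0, (1 : R)[.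
  apply/funext => s; rewrite add0r !patchE.
  congr (if _ then _ else _).
  by apply/idP/idP; rewrite !inE/= !in_itv/= => /andP[a b]; apply/andP; split; nra.
by move=> ->; rewrite muleA -EFinM divff ?gt_eqF// mul1e.
Qed.

Lemma integral_flip (t : R) (F : R -> \bar R) :
  measurable_fun `]0, t[ F ->
  (\int[mu]_(s in `]0%R, t[) F s = \int[mu]_(s in `]0%R, t[) F (t - s)%R)%E.
Proof.
move=> mF; rewrite integral_mkcond [in RHS]integral_mkcond.
have mF' : measurable_fun setT (F \_ `]0, t[) by apply/(measurable_restrictT F).
rewrite -(integral_reflect t mF'); apply: eq_integral => s _; rewrite !patchE.
congr (if _ then _ else _).
by apply/idP/idP; rewrite !inE/= !in_itv/= => /andP[a b]; apply/andP; split; lra.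
Qed.

Lemma measurable_flip (t : R) (F : R -> \bar R) :
  measurable_fun `]0, t[ F -> measurable_fun `]0, t[ (fun s => F (t - s)).
Proof.
move=> mF; apply: (measurable_comp _ _ mF) => //=.
  by move=> _ [s /= + <-]; rewrite !in_itv/= => /andP[a b]; apply/andP; split; lra.
by apply: measurable_funB.
Qed.

Lemma integrable_scale (t : R) (F : R -> \bar R) : 0 < t ->
  measurable_fun `]0, t[ F -> mu.-integrable `]0, (1 : R)[ (fun s => F (t * s)) ->
  mu.-integrable `]0, t[ F.
Proof.
move=> t0 mF /integrableP[_ iF]; apply/integrableP; split => //.
rewrite integral_scale//; last exact: measurableT_comp.
by rewrite lte_mul_pinfty// ?lee_fin ?ltW.
Qed.

Lemma integrable_flip (t : R) (F : R -> \bar R) :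
  mu.-integrable `]0, t[ F -> mu.-integrable `]0, t[ (fun s => F (t - s)).
Proof.
move=> /integrableP[mF iF]; apply/integrableP; split; first exact: measurable_flip.
by rewrite -(@integral_flip _ (fun s => `|F s|%E))//; exact: measurableT_comp.
Qed.

End IntervalChangeOfVariables.

Section BetaWeight.
Variable R : realType.
Local Notation mu := (@lebesgue_measure R).
Implicit Types p s t : R.

(** The antiderivative is t^p / p. Starting at a > 0 avoids the singularity at 0, and a bound
    uniform in a survives the limit a -> 0 in [integrable_powR01]. *)
Lemma integral_powR_le p (a : R) : 0 < p -> 0 < a < 1 ->
  (\int[mu]_(s in `[a, 1%R]) (s `^ (p - 1))%:E <= (p^-1)%:E)%E.
Proof.
move=> p0 /andP[a0 a1].
have dF (x : R) : 0 < x -> is_derive x 1 (fun y : R => p^-1 * y `^ p) (x `^ (p - 1)).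
  move=> x0; have := is_derive1_powR p x0 => h.
  have -> : x `^ (p - 1) = p^-1 *: (p * x `^ (p - 1)).
    by rewrite /GRing.scale/= mulrA mulVf ?gt_eqF// mul1r.
  exact: is_deriveZ.
have cont (g : R -> R) (dg : R -> R) : (forall x : R, 0 < x -> is_derive x 1 g (dg x)) ->
    forall x : R, 0 < x -> {for x, continuous g}.
  move=> h x x0; apply: differentiable_continuous.
  by apply/derivable1_diffP; have [] := h x x0.
rewrite (@continuous_FTC2 _ _ (fun y : R => p^-1 * y `^ p))//.
- rewrite powR1 mulr1 -EFinB lee_fin gerBl mulr_ge0 ?invr_ge0 ?powR_ge0 ?ltW//.
- apply: continuous_in_subspaceT => x; rewrite inE/= in_itv/= => /andP[ax _].
  by apply: (cont _ _ (is_derive1_powR (p - 1))); exact: lt_le_trans ax.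
- split.
  + by move=> x; rewrite in_itv/= => /andP[ax _]; have [] := dF x (lt_trans a0 ax).
  + by apply: cvg_at_right_filter; exact: (cont _ _ dF).
  + by apply: cvg_at_left_filter; exact: (cont _ _ dF).
- move=> x; rewrite in_itv/= => /andP[ax _]; rewrite derive1E.
  by have [_ ->] := dF x (lt_trans a0 ax).
Qed.

Lemma integrable_powR01 p : 0 < p ->
  mu.-integrable `]0, (1 : R)[ (fun s => (s `^ (p - 1))%:E).
Proof.
(* Exhaustion for monotone convergence; n + 2 keeps the left end strictly below 1 already for n =
   0. *)
move=> p0; pose F (n : nat) : set R := `[(n.+2%:R)^-1, 1]%classic.
have mpow (A : set R) : measurable_fun A (fun s : R => (s `^ (p - 1))%:E).
  by apply/measurable_EFinP; apply: measurable_funTS; exact: measurable_powR.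
have sub : `]0%R, 1%R[ `<=` \bigcup_n F n.
  move=> s /=; rewrite in_itv/= => /andP[s0 s1].
  exists (Num.truncn s^-1) => //; rewrite /F/= in_itv/= (ltW s1) andbT.
  rewrite -[leRHS]invrK lef_pV2 ?posrE ?invr_gt0//.
  have := truncnS_gt s^-1; move/ltW/le_trans; apply.
  by rewrite ler_nat.
have mF n : measurable (F n) by exact: measurable_itv.
have ndF : {homo F : n m / (n <= m)%N >-> (n <= m)%O}.
  move=> n m nm; apply/subsetPset => s; rewrite /F/= !in_itv/= => /andP[ns ->].
  by rewrite andbT (le_trans _ ns)// lef_pV2 ?posrE// ler_nat !ltnS.
have := @ge0_nondecreasing_set_cvg_integral _ (measurableTypeR R) R F
  (fun s : R => (s `^ (p - 1))%:E) mu ndF mF (fun n => mpow _) (fun n s _ => powR_ge0 s (p - 1)) => cv.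
have le1 : (\int[mu]_(s in \bigcup_n F n) (s `^ (p - 1))%:E <= (p^-1)%:E)%E.
  rewrite -(cvg_lim _ cv)//; apply: lime_le; first by apply/cvg_ex; eexists; exact: cv.
  apply: nearW => n; apply: integral_powR_le => //.
  by rewrite invr_gt0 ltr0n/= invf_lt1// ltr1n.
apply/integrableP; split; first exact: mpow.
under eq_integral do rewrite gee0_abs ?lee_fin ?powR_ge0//.
apply: (@le_lt_trans _ _ ((p^-1)%:E)); last exact: ltry.
apply: le_trans le1; apply: ge0_subset_integral => //.
- by apply: bigcup_measurable => n _; exact: mF.
- exact: mpow.
- by move=> s _; rewrite lee_fin powR_ge0.
Qed.

(** The unnormalised density of the Beta(p, p) distribution: what remains of the two power factors
    of a convolution once t is scaled out. *)
Definition bweight p s : R := s `^ (p - 1) * (1 - s) `^ (p - 1).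

Lemma bweight_ge0 p s : 0 <= bweight p s.
Proof. by rewrite mulr_ge0 ?powR_ge0. Qed.

Lemma measurable_bweight p (A : set R) : measurable_fun A (bweight p).
Proof.
apply: measurable_funTS; apply: measurable_funM; first exact: measurable_powR.
apply: (@measurableT_comp _ _ _ _ _ _ (fun s : R => s `^ (p - 1))).
  exact: measurable_powR.
exact: measurable_funB.
Qed.

Lemma integrable_bweight p : 0 < p <= 1 ->
  mu.-integrable `]0, (1 : R)[ (EFin \o bweight p).
Proof.
move=> /andP[p0 p1]; have ip := integrable_powR01 p0.
have iq := integrable_flip ip.
have iS : mu.-integrable `]0, (1 : R)[
    (fun s => ((2^-1) `^ (p - 1))%:E * ((s `^ (p - 1))%:E + ((1 - s) `^ (p - 1))%:E))%E.
  by apply: integrableZl => //; exact: integrableD.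
apply: le_integrable iS => //; first by apply/measurable_EFinP; exact: measurable_bweight.
move=> s /=; rewrite in_itv/= => /andP[s0 s1].
rewrite !lee_fin !ger0_norm ?mulr_ge0 ?addr_ge0 ?powR_ge0//.
have dec (x : R) : 2^-1 <= x -> x `^ (p - 1) <= (2^-1) `^ (p - 1).
  move=> x2; have x0 : 0 < x by apply: lt_le_trans x2; rewrite invr_gt0.
  rewrite -[p - 1]opprB !powRN lef_pV2 ?posrE ?powR_gt0//.
  by rewrite ge0_ler_powR ?nnegrE ?subr_ge0// ?invr_ge0// ltW.
(* One of s and 1 - s is at least 1/2, and its power is then bounded. *)
rewrite mulrDr /bweight; have [h|h] := lerP (2^-1) s.
  by rewrite ler_wpDl ?mulr_ge0 ?powR_ge0// ler_wpM2r ?powR_ge0// dec.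
rewrite ler_wpDr ?mulr_ge0 ?powR_ge0// mulrC ler_wpM2r ?powR_ge0// dec//; lra.
Qed.

End BetaWeight.

(** * Real convolution of power-like functions *)

Section ScaledConvolution.
Variable R : realType.
Local Notation mu := (@lebesgue_measure R).
Local Notation I01 := (`]0, (1 : R)[%classic).
Implicit Types p s t T : R.

Definition rconv (f g : R -> R) (t : R) : R :=
  \int[mu]_(s in `]0, t[) (f s * g (t - s)).

(* The norm of t, rather than t, keeps sconv p u v continuous on the whole line. *)
Definition sconv p (u v : R -> R) (t : R) : R :=
  `|t| `^ p * \int[mu]_(s in I01) (bweight p s * (u (t * s) * v (t * (1 - s)))).

Lemma mem01 s : s \in I01 -> 0 < s < 1.
Proof. by rewrite inE/= in_itv. Qed.

Lemma continuous_bounded (u : R -> R) T : continuous u ->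
  exists2 M, 0 < M & forall t, `|t| <= T -> `|u t| <= M.
Proof.
move=> cu; have [T0|T0] := lerP 0 T; last first.
  by exists 1 => // t tT; have := le_lt_trans tT T0; rewrite normr_lt0.
have cu' : {within `[- T, T], continuous (fun t => `|u t|)}.
  by apply: continuous_subspaceT => x; apply: cvg_norm; exact: cu.
have [c _ hc] := EVT_max (ge0_cp T0).2 cu'.
exists (`|u c| + 1); first by rewrite ltr_wpDl.
move=> t tT; rewrite (le_trans (hc t _))// ?in_itv/= -?ler_norml// lerDl//.
Qed.

Lemma scaled_bound (u : R -> R) M T t s : (forall t, `|t| <= T -> `|u t| <= M) ->
  `|t| <= T -> 0 <= s <= 1 -> `|u (t * s)| <= M.
Proof.
move=> uM tT /andP[s0 s1]; apply: uM; rewrite normrM (ger0_norm s0).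
by apply: le_trans tT; rewrite ler_piMr.
Qed.

Lemma integrable_bweightM p (b : R -> R) M : 0 < p <= 1 ->
  measurable_fun I01 b -> (forall s, 0 < s < 1 -> `|b s| <= M) ->
  mu.-integrable I01 (fun s => (bweight p s * b s)%:E).
Proof.
move=> p01 mb bM.
have ib := integrable_bweight p01.
have iM : mu.-integrable I01 (fun s => M%:E * (bweight p s)%:E)%E.
  exact: integrableZl.
apply: le_integrable iM => //.
  by apply/measurable_EFinP; apply: measurable_funM => //; exact: measurable_bweight.
move=> s /=; rewrite in_itv/= => s01.
rewrite lee_fin !normrM mulrC ler_wpM2r//.
exact: le_trans (bM _ s01) (ler_norm _).
Qed.

Lemma measurable_scaled (u v : R -> R) t (A : set R) : continuous u -> continuous v ->
  measurable_fun A (fun s => u (t * s) * v (t * (1 - s))).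
Proof.
move=> cu cv; apply: measurable_funTS.
apply: measurable_funM.
  apply: (measurableT_comp (continuous_measurable_fun cu)); exact: measurable_funM.
apply: (measurableT_comp (continuous_measurable_fun cv)).
by apply: measurable_funM => //; exact: measurable_funB.
Qed.

Lemma integrable_sconv p (u v : R -> R) t : 0 < p <= 1 ->
  continuous u -> continuous v ->
  mu.-integrable I01 (fun s => (bweight p s * (u (t * s) * v (t * (1 - s))))%:E).
Proof.
move=> p01 cu cv.
have [A A0 uA] := continuous_bounded `|t| cu.
have [B B0 vB] := continuous_bounded `|t| cv.
apply: (@integrable_bweightM _ _ (A * B)) => //; first exact: measurable_scaled.
move=> s /andP[s0 s1]; rewrite normrM ler_pM//.
  by apply: scaled_bound uA _ _ => //; rewrite !ltW.
by apply: scaled_bound vB _ _ => //; rewrite subr_ge0 gerBl !ltW.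
Qed.

Lemma continuous_powR_gt0 p t : 0 < t -> {for t, continuous (fun x : R => x `^ p)}.
Proof.
move=> t0; apply: differentiable_continuous; apply/derivable1_diffP.
by have [] := is_derive1_powR p t0.
Qed.

Lemma continuous_normr_powR p : 0 < p -> continuous (fun t : R => `|t| `^ p).
Proof.
move=> p0 t; have [->|t0] := eqVneq t 0.
  rewrite /continuous_at normr0 powR0 ?gt_eqF//.
  have h := powR_cvg0 p0.
  apply/cvgrPdist_lt => e e0; move/cvgrPdist_lt : h => /(_ _ e0) [d /= d0 hd].
  exists d => //= x; rewrite sub0r normrN => xd.
  have [->|x0] := eqVneq x 0; first by rewrite normr0 powR0 ?gt_eqF// normr0.
  have := hd `|x|; rewrite /= !sub0r !normrN normr_id; apply => //.
    by move: xd; rewrite /ball_/= sub0r normrN.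
  by rewrite normr_gt0.
apply: (@continuous_comp _ _ _ (@Num.norm R R) (fun y => y `^ p)); first exact: norm_continuous.
by apply: continuous_powR_gt0; rewrite normr_gt0.
Qed.

Lemma continuous_scaled (u : R -> R) s : continuous u -> continuous (fun t => u (t * s)).
Proof.
move=> cu t; apply: (@continuous_comp _ _ _ (fun t => t * s) u); last exact: cu.
exact: mulrr_continuous.
Qed.

Lemma continuous_sconv p (u v : R -> R) : 0 < p <= 1 ->
  continuous u -> continuous v -> continuous (sconv p u v).
Proof.
move=> p01 cu cv t.
have [p0 p1] := andP p01.
rewrite /continuous_at /sconv; apply: cvgM; first exact: continuous_normr_powR.
(* T bounds all points of ]t - 1, t + 1[, so that A B times the weight dominates the integrands
   uniformly near t. *)
pose T := `|t| + 1.
have [A A0 uA] := continuous_bounded T cu.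
have [B B0 vB] := continuous_bounded T cv.
have T_ (x : R) : (t - 1 < x < t + 1) -> `|x| <= T.
  move=> /andP[h1 h2]; rewrite /T ler_norml; have := ler_norm t; have := ler_norm (- t).
  rewrite normrN; lra.
apply: (@continuity_under_integral R _ _ mu
  (fun x s => bweight p s * (u (x * s) * v (x * (1 - s)))) _ _ (t - 1) (t + 1) _ _
  (fun s => (A * B) * bweight p s)) => //.
- by move=> x _; exact: integrable_sconv.
- apply: aeW => s _ x _.
  rewrite /continuous_at; apply: cvgM; first exact: cvg_cst.
  apply: cvgM.
    exact: (continuous_scaled cu).
  exact: (continuous_scaled cv).
- apply: (@integrableZl _ _ _ mu _ _ (A * B) (EFin \o bweight p)) => //.
  exact: integrable_bweight.
- move=> x; rewrite /= in_itv/= => /T_ xT.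
  apply: aeW => s; rewrite /= in_itv/= => /andP[s0 s1].
  rewrite normrM ger0_norm ?bweight_ge0// [leRHS]mulrC ler_wpM2l ?bweight_ge0//.
  rewrite normrM ler_pM//.
    by apply: scaled_bound uA _ _ => //; rewrite !ltW.
  by apply: scaled_bound vB _ _ => //; rewrite subr_ge0 gerBl !ltW.
- by rewrite inE/= in_itv/=; apply/andP; split; lra.
Qed.

End ScaledConvolution.

Section RealConvolution.
Variable R : realType.
Local Notation mu := (@lebesgue_measure R).
Local Notation I01 := (`]0, (1 : R)[%classic).
Implicit Types p s t T : R.
Implicit Types f g h u v : R -> R.

(** Continuity of u on the whole line keeps subspace topologies out of the estimates;
    [continuous_fold_normr] produces such a u from a function continuous on the half-line. *)
Definition rpowerlike p f : Prop :=
  exists2 u, continuous u & forall t, 0 < t -> f t = t `^ (p - 1) * u t.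

Lemma measurable_rpowerlike p f t : rpowerlike p f -> measurable_fun `]0, t[ f.
Proof.
move=> [u cu fE].
apply: (eq_measurable_fun (fun s => s `^ (p - 1) * u s)).
  by move=> s; rewrite inE/= in_itv/= => /andP[s0 _]; rewrite fE.
apply: measurable_funTS; apply: measurable_funM; first exact: measurable_powR.
exact: continuous_measurable_fun.
Qed.

Lemma measurable_rconv p f g t : rpowerlike p f -> rpowerlike p g ->
  measurable_fun `]0, t[ (fun s => (f s * g (t - s))%:E).
Proof.
move=> pf pg; apply/measurable_EFinP; apply: measurable_funM.
  exact: measurable_rpowerlike pf.
have /measurable_EFinP mg := measurable_rpowerlike (t := t) pg.
by have /measurable_EFinP := measurable_flip mg.
Qed.

Section Scaled.
Variables (p : R) (f g u v : R -> R).
Hypotheses (p01 : 0 < p <= 1) (cu : continuous u) (cv : continuous v).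
Hypothesis fE : forall t, 0 < t -> f t = t `^ (p - 1) * u t.
Hypothesis gE : forall t, 0 < t -> g t = t `^ (p - 1) * v t.

Let pf : rpowerlike p f. Proof. by exists u. Qed.
Let pg : rpowerlike p g. Proof. by exists v. Qed.

Lemma rconv_integrandE t s : 0 < t -> 0 < s < 1 ->
  f (t * s) * g (t - t * s) =
  t `^ (p - 1) * t `^ (p - 1) * (bweight p s * (u (t * s) * v (t * (1 - s)))).
Proof.
move=> t0 /andP[s0 s1]; have s1' : 0 < 1 - s by rewrite subr_gt0.
have -> : t - t * s = t * (1 - s) by ring.
by rewrite fE ?gE ?mulr_gt0// /bweight !powRM ?ltW//; ring.
Qed.

Lemma integrable_rconv_scaled t : 0 < t ->
  mu.-integrable `]0, t[ (fun s => (f s * g (t - s))%:E).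
Proof.
move=> t0; apply: integrable_scale => //; first exact: measurable_rconv pf pg.
pose c := t `^ (p - 1) * t `^ (p - 1).
have : mu.-integrable I01
    (fun s => c%:E * (bweight p s * (u (t * s) * v (t * (1 - s))))%:E)%E.
  by apply: integrableZl => //; exact: integrable_sconv.
by apply: eq_integrable => // s /mem01 s01; rewrite -EFinM rconv_integrandE.
Qed.

Lemma rconv_scaled t : 0 < t -> rconv f g t = t `^ (p - 1) * sconv p u v t.
Proof.
move=> t0; have [p0 _] := andP p01.
rewrite /rconv /Rintegral integral_scale//; last exact: measurable_rconv pf pg.
pose c := t `^ (p - 1) * t `^ (p - 1).
rewrite (_ : (\int[mu]_(s in I01) _)%E = \int[mu]_(s in I01)
    (c%:E * (bweight p s * (u (t * s) * v (t * (1 - s))))%:E)%E)%E; last first.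
  by apply: eq_integral => s /mem01 s01; rewrite -EFinM rconv_integrandE.
rewrite integralZl//; last exact: integrable_sconv.
rewrite muleA -EFinM fineM//; last first.
  by apply: integrable_fin_num => //; exact: integrable_sconv.
(* The Jacobian t and one of the two factors t^(p-1) make up the t^p of [sconv]; the other factor
   stays in front. *)
rewrite /sconv gtr0_norm// -(mulr_powRB1 (ltW t0) p0) /c /Rintegral/=; ring.
Qed.

End Scaled.

Lemma integrable_rconv p f g t : 0 < p <= 1 -> rpowerlike p f -> rpowerlike p g ->
  0 < t -> mu.-integrable `]0, t[ (fun s => (f s * g (t - s))%:E).
Proof. by move=> p01 [u cu fE] [v cv gE]; exact: (integrable_rconv_scaled p01 cu cv fE gE). Qed.

Lemma rpowerlike_rconv p f g : 0 < p <= 1 -> rpowerlike p f -> rpowerlike p g ->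
  rpowerlike p (rconv f g).
Proof.
move=> p01 [u cu fE] [v cv gE]; exists (sconv p u v); first exact: continuous_sconv.
by move=> t t0; exact: (rconv_scaled p01 cu cv fE gE t0).
Qed.

Lemma rpowerlikeD p f g : rpowerlike p f -> rpowerlike p g ->
  rpowerlike p (fun t => f t + g t).
Proof.
move=> [u cu fE] [v cv gE]; exists (fun t => u t + v t).
  by move=> t; apply: cvgD; [exact: cu|exact: cv].
by move=> t t0; rewrite fE// gE// mulrDr.
Qed.

Lemma rpowerlikeB p f g : rpowerlike p f -> rpowerlike p g ->
  rpowerlike p (fun t => f t - g t).
Proof.
move=> [u cu fE] [v cv gE]; exists (fun t => u t - v t).
  by move=> t; apply: cvgB; [exact: cu|exact: cv].
by move=> t t0; rewrite fE// gE// mulrBr.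
Qed.

Lemma rpowerlikeZ p (a : R) f : rpowerlike p f -> rpowerlike p (fun t => a * f t).
Proof.
move=> [u cu fE]; exists (fun t => a * u t).
  by move=> t; apply: cvgM; [exact: cvg_cst|exact: cu].
by move=> t t0; rewrite fE// mulrCA.
Qed.

Lemma rpowerlike_norm p f : rpowerlike p f -> rpowerlike p (fun t => `|f t|).
Proof.
move=> [u cu fE]; exists (fun t => `|u t|).
  by move=> t; apply: cvg_norm; exact: cu.
by move=> t t0; rewrite fE// normrM (ger0_norm (powR_ge0 _ _)).
Qed.

(** The surplus t^(q-p) is absorbed into the continuous factor. This is how functions with different
    exponents are brought to a common one. *)
Lemma rpowerlike_lt p q f : p <= q -> rpowerlike q f -> rpowerlike p f.
Proof.
rewrite le_eqVlt => /predU1P[->//|pq] [u cu fE].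
exists (fun t => `|t| `^ (q - p) * u t).
  by move=> t; apply: cvgM; [apply: continuous_normr_powR; rewrite subr_gt0|exact: cu].
move=> t t0; rewrite fE// gtr0_norm// mulrA -powRD; last by rewrite (gt_eqF t0) implybT.
by congr (_ `^ _ * _); ring.
Qed.

(** A constant has exponent 1, hence every smaller one. *)
Lemma rpowerlike_cst p (a : R) : p <= 1 -> rpowerlike p (fun=> a).
Proof.
move=> p1; apply: (rpowerlike_lt p1); exists (fun=> a); first exact: cst_continuous.
by move=> t _; rewrite subrr powRr0 mul1r.
Qed.

Lemma eq_rconv f f' g g' t :
  (forall s, 0 < s < t -> f s = f' s) -> (forall s, 0 < s < t -> g s = g' s) ->
  rconv f g t = rconv f' g' t.
Proof.
move=> ff gg; apply: eq_Rintegral => s; rewrite inE/= in_itv/= => /andP[s0 st].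
by rewrite ff ?s0// gg// subr_gt0 st gtrBl.
Qed.

Lemma rconvDl p f1 f2 g t : 0 < p <= 1 -> rpowerlike p f1 -> rpowerlike p f2 ->
  rpowerlike p g -> 0 < t ->
  rconv (fun s => f1 s + f2 s) g t = rconv f1 g t + rconv f2 g t.
Proof.
move=> p01 pf1 pf2 pg t0; rewrite /rconv -RintegralD//.
- by apply: eq_Rintegral => s _; rewrite mulrDl.
- exact: (integrable_rconv p01 pf1 pg t0).
- exact: (integrable_rconv p01 pf2 pg t0).
Qed.

Lemma rconvBl p f1 f2 g t : 0 < p <= 1 -> rpowerlike p f1 -> rpowerlike p f2 ->
  rpowerlike p g -> 0 < t ->
  rconv (fun s => f1 s - f2 s) g t = rconv f1 g t - rconv f2 g t.
Proof.
move=> p01 pf1 pf2 pg t0; rewrite /rconv -RintegralB//.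
- by apply: eq_Rintegral => s _; rewrite mulrBl.
- exact: (integrable_rconv p01 pf1 pg t0).
- exact: (integrable_rconv p01 pf2 pg t0).
Qed.

Lemma rconvZl p (a : R) f g t : 0 < p <= 1 -> rpowerlike p f -> rpowerlike p g ->
  0 < t -> rconv (fun s => a * f s) g t = a * rconv f g t.
Proof.
move=> p01 pf pg t0; rewrite /rconv -RintegralZl//.
- by apply: eq_Rintegral => s _; rewrite mulrA.
- exact: (integrable_rconv p01 pf pg t0).
Qed.

Lemma rconvC p f g t : rpowerlike p f -> rpowerlike p g ->
  rconv f g t = rconv g f t.
Proof.
move=> pf pg; rewrite /rconv /Rintegral integral_flip//; last exact: measurable_rconv pf pg.
by congr fine; apply: eq_integral => s _; rewrite subKr mulrC.
Qed.

Lemma rconvDr p f g1 g2 t : 0 < p <= 1 -> rpowerlike p f -> rpowerlike p g1 ->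
  rpowerlike p g2 -> 0 < t ->
  rconv f (fun s => g1 s + g2 s) t = rconv f g1 t + rconv f g2 t.
Proof.
move=> p01 pf pg1 pg2 t0; rewrite (rconvC t pf (rpowerlikeD pg1 pg2)).
by rewrite (rconvDl p01)// -(rconvC t pf pg1) -(rconvC t pf pg2).
Qed.

Lemma rconvBr p f g1 g2 t : 0 < p <= 1 -> rpowerlike p f -> rpowerlike p g1 ->
  rpowerlike p g2 -> 0 < t ->
  rconv f (fun s => g1 s - g2 s) t = rconv f g1 t - rconv f g2 t.
Proof.
move=> p01 pf pg1 pg2 t0; rewrite (rconvC t pf (rpowerlikeB pg1 pg2)).
by rewrite (rconvBl p01)// -(rconvC t pf pg1) -(rconvC t pf pg2).
Qed.

Lemma rconv1_eq0 p h : 0 < p <= 1 -> rpowerlike p h ->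
  (forall t, 0 < t -> rconv (fun=> 1) h t = 0) -> forall t, 0 < t -> h t = 0.
Proof.
move=> p01 ph h0 x x0; have [p0 p1] := andP p01.
have ph1 := rpowerlike_cst 1 p1.
have ih t : 0 < t -> mu.-integrable `]0, t[ (EFin \o h).
  move=> t0; have := integrable_rconv p01 ph ph1 t0.
  by apply: eq_integrable => // s _; rewrite mulr1.
(* The vanishing convolution is the primitive of h; the endpoint t is added to match the interval in
   [continuous_FTC1]. *)
have Ih t : 0 < t -> \int[mu]_(s in `]0, t]) h s = 0.
  move=> t0; rewrite -Rintegral_itv_bndo_bndc//; last exact: ih.
  rewrite -[RHS](h0 _ t0) (rconvC t ph1 ph).
  by apply: eq_Rintegral => s _; rewrite mulr1.
(* The formula for h holds at positive points only, so continuity is transferred from t^(p-1) u(t)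
   on a neighbourhood of x inside ]0, +oo[. *)
have ch : {for x, continuous h}.
  have [u cu hE] := ph.
  have : {for x, continuous (fun t => t `^ (p - 1) * u t)}.
    rewrite /prop_for /continuous_at; apply: cvgM; last exact: cu.
    exact: (continuous_powR_gt0 x0).
  rewrite /prop_for /continuous_at -hE// => hx.
  apply: cvg_trans hx; apply: near_eq_cvg; near=> t.
  rewrite hE//; near: t; exact: lt_nbhsr.
have ih2 : mu.-integrable [set` Interval (BRight 0) (BRight (x + 1))] (EFin \o h).
  apply: (integrableS _ _ _ (ih (x + 2) _)) => //; last by rewrite addr_gt0.
  by apply: subset_itvl; rewrite bnd_simp; lra.
have x0' : (BRight 0 < BRight x)%O by rewrite bnd_simp.
have [_ <-] := continuous_FTC1 (ltr_pwDr ltr01 (lexx x)) ih2 x0' ch.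
rewrite derive1E.
transitivity ('D_1 (cst 0 : R -> R) x); last exact: derive_cst.
apply: near_eq_derive.
near=> t; rewrite Ih//; near: t; exact: lt_nbhsr.
Unshelve. all: by end_near. Qed.

End RealConvolution.

Section Associativity.
Variable R : realType.
Local Notation mu := (@lebesgue_measure R).
Implicit Types p s t : R.
Implicit Types f g h : R -> R.

(** Extension by 0 turns a convolution over ]0, t[ into an integral over the line, so Fubini meets
    no variable domain. *)
Definition cut f s : R := if 0 < s then f s else 0.

Lemma cut_norm f s : `|cut f s| = cut (fun t => `|f t|) s.
Proof. by rewrite /cut; case: ifP; rewrite ?normr0. Qed.

Lemma measurable_cut p f : rpowerlike p f -> measurable_fun setT (cut f).
Proof.
move=> [u cu fE].
have -> : cut f = (fun t => t `^ (p - 1) * u t) \_ `]0, +oo[.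
  apply/funext => s; rewrite /cut patchE mem_setE in_itv/= andbT.
  by case: ifP => // s0; rewrite fE.
have m : measurable_fun setT (fun t : R => t `^ (p - 1) * u t).
  apply: measurable_funM; first exact: measurable_powR.
  exact: continuous_measurable_fun.
apply/(measurable_restrictT (fun t : R => t `^ (p - 1) * u t)) => //.
exact: measurable_funTS.
Qed.

Lemma cut_conv_restrict f g s :
  (fun x => cut f x * cut g (s - x)) = (fun x => f x * g (s - x)) \_ `]0, s[.
Proof.
apply/funext => x; rewrite /cut patchE mem_setE in_itv/= subr_gt0.
by case: (0 < x); case: (x < s); rewrite ?mulr0 ?mul0r.
Qed.

(** For s <= 0 the interval is empty and both sides vanish; having every real s makes the identity
    usable under an outer integral. *)
Lemma integral_cut p f g s : 0 < p <= 1 -> rpowerlike p f -> rpowerlike p g ->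
  mu.-integrable setT (fun x => (cut f x * cut g (s - x))%:E) /\
  (\int[mu]_x (cut f x * cut g (s - x))%:E = (cut (rconv f g) s)%:E)%E.
Proof.
move=> p01 pf pg.
have E : (fun x => (cut f x * cut g (s - x))%:E) =
    (fun x => (f x * g (s - x))%:E) \_ `]0, s[.
  apply/funext => x; have /(congr1 (fun F => F x)) -> := cut_conv_restrict f g s.
  by rewrite !patchE; case: ifP.
rewrite E -integral_mkcond /cut.
have [s0|s0] := ltP 0 s.
  have ifg := integrable_rconv p01 pf pg s0; split.
    by rewrite -integrable_mkcond.
  by rewrite fineK//; exact: integrable_fin_num.
rewrite set_itv_ge -?leNgt ?bnd_simp// patch_set0 integral_set0; split => //.
exact: integrable0.
Qed.

(** Fubini for the kernel f(x) g(s - x) h(t - s): integration in x first produces f * g inside,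
    integration in s first produces g * h at t - x. *)
Lemma rconvA p f g h t : 0 < p <= 1 -> rpowerlike p f -> rpowerlike p g ->
  rpowerlike p h -> 0 < t -> rconv f (rconv g h) t = rconv (rconv f g) h t.
Proof.
move=> p01 pf pg ph t0.
have pfg := rpowerlike_rconv p01 pf pg; have pgh := rpowerlike_rconv p01 pg ph.
pose K (z : measurableTypeR R * measurableTypeR R) : \bar R :=
  (cut f z.1 * (cut g (z.2 - z.1) * cut h (t - z.2)))%:E.
have mK : measurable_fun setT K.
  apply/measurable_EFinP; apply: measurable_funM.
    exact: (measurableT_comp (measurable_cut pf)).
  apply: measurable_funM.
    apply: (measurableT_comp (measurable_cut pg)).
    exact: measurable_funB.
  apply: (measurableT_comp (measurable_cut ph)).
  exact: measurable_funB.
have inner2 f' g' h' s : rpowerlike p f' -> rpowerlike p g' ->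
    (\int[mu]_x (cut f' x * (cut g' (s - x) * cut h' (t - s)))%:E =
     (cut (rconv f' g') s * cut h' (t - s))%:E)%E.
  move=> pf' pg'; have [i e] := integral_cut s p01 pf' pg'.
  transitivity (\int[mu]_x ((cut h' (t - s))%:E * (cut f' x * cut g' (s - x))%:E))%E.
    by apply: eq_integral => x _; rewrite -EFinM; congr EFin; ring.
  by rewrite integralZl// e -EFinM mulrC.
(* Tonelli: the absolute values are power-like too, so the same inner integration turns the double
   integral of |K| into a finite convolution. *)
have iK : (mu \x mu)%E.-integrable setT K.
  apply/integrable21ltyP => //.
  have [i e] := integral_cut t p01
    (rpowerlike_rconv p01 (rpowerlike_norm pf) (rpowerlike_norm pg)) (rpowerlike_norm ph).
  suff -> : (\int[mu]_s \int[mu]_x `|K (x, s)| =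
      \int[mu]_s (cut (rconv (fun t => `|f t|) (fun t => `|g t|)) s
        * cut (fun t => `|h t|) (t - s))%:E)%E by rewrite e ltry.
  apply: eq_integral => s _.
  rewrite -inner2; [|exact: rpowerlike_norm|exact: rpowerlike_norm].
  by apply: eq_integral => x _; rewrite /K/= !normrM !cut_norm.
have := Fubini iK.
rewrite [X in X = _](_ : _ = (rconv f (rconv g h) t)%:E); last first.
  have [_ e] := integral_cut t p01 pf pgh.
  rewrite /cut t0 in e; rewrite -e.
  apply: eq_integral => x _; rewrite /K/=.
  have [i1 e1] := integral_cut (t - x) p01 pg ph.
  have mG : measurable_fun setT (fun s => (cut g (s - x) * cut h (t - s))%:E).
    apply/measurable_EFinP; apply: measurable_funM.
      by apply: (measurableT_comp (measurable_cut pg)); exact: measurable_funB.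
    by apply: (measurableT_comp (measurable_cut ph)); exact: measurable_funB.
  (* The translation s -> x + s recentres the inner integral as the convolution of g and h at t -
     x. *)
  have Gt (s : R) : (cut g (x + 1 * s - x) * cut h (t - (x + 1 * s)))%:E =
      (cut g s * cut h (t - x - s))%:E.
    by congr (cut g _ * cut h _)%:E; ring.
  have iG : mu.-integrable setT (fun s => (cut g (s - x) * cut h (t - s))%:E).
    apply/integrableP; split => //.
    have := integral_affine x ltr01 (_ : measurable_fun setT
      (fun s => `|(cut g (s - x) * cut h (t - s))%:E|%E)).
    rewrite invr1 mul1e => <-; last exact: measurableT_comp.
    under eq_integral do rewrite Gt.
    by have /integrableP[] := i1.
  have eG := integral_affine x ltr01 mG.
  rewrite invr1 mul1e in eG.
  under eq_integral do rewrite EFinM.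
  rewrite integralZl//= -eG.
  under eq_integral do rewrite Gt.
  by rewrite e1.
rewrite [X in _ = X](_ : _ = (rconv (rconv f g) h t)%:E); last first.
  have [_ e] := integral_cut t p01 pfg ph.
  rewrite /cut t0 in e; rewrite -e.
  by apply: eq_integral => s _; rewrite inner2.
by case.
Qed.

End Associativity.

(** * Locally normal series and Neumann series *)

Section Series.
Variable R : realType.
Local Notation mu := (@lebesgue_measure R).
Local Notation I01 := (`]0, (1 : R)[%classic).
Implicit Types p s t T : R.
Implicit Types u v w : R -> R.

(** For p > 0 this is Euler's beta function at (p, (n + 1) p). No closed form is used: the ratio
    test needs only its limit. *)
Definition beta_moment p (n : nat) : R :=
  \int[mu]_(s in I01) (bweight p s * ((1 - s) `^ p) ^+ n).

Lemma powR01 p s : 0 < p -> 0 < s < 1 -> 0 <= (1 - s) `^ p < 1.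
Proof.
move=> p0 /andP[s0 s1]; rewrite powR_ge0/=.
have : (1 - s) `^ p < 1 `^ p.
  by apply: gt0_ltr_powR; rewrite ?nnegrE ?subr_ge0 ?(ltW s1)// gtrBl.
by rewrite powR1.
Qed.

Lemma measurable_powR_onem p n (A : set R) :
  measurable_fun A (fun s : R => ((1 - s) `^ p) ^+ n).
Proof.
apply: measurable_funX.
apply: (measurableT_comp (@measurable_powR R p)).
by apply: measurable_funB.
Qed.

Lemma integrable_beta_moment p n : 0 < p <= 1 ->
  mu.-integrable I01 (fun s => (bweight p s * ((1 - s) `^ p) ^+ n)%:E).
Proof.
move=> p01; apply: (@integrable_bweightM _ _ _ 1) => //.
  exact: measurable_powR_onem.
move=> s /powR01-/(_ p) /(_ (andP p01).1) /andP[a b].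
by rewrite ger0_norm ?exprn_ge0// exprn_ile1// ltW.
Qed.

Lemma beta_moment_ge0 p n : 0 <= beta_moment p n.
Proof.
apply: Rintegral_ge0 => s _.
by rewrite mulr_ge0 ?bweight_ge0// exprn_ge0// powR_ge0.
Qed.

(** Dominated convergence: (1 - s)^p < 1 inside the interval, so its powers tend to 0 under the
    integrable majorant [bweight p]. *)
Lemma cvg_beta_moment p : 0 < p <= 1 -> beta_moment p n @[n --> \oo] --> 0.
Proof.
move=> p01; have -> : 0 = fine (\int[mu]_(s in I01) (cst 0%E s))%E :> R.
  by rewrite integral0.
apply: fine_cvg; rewrite fineK; last by rewrite integral0.
apply: (@dominated_cvg _ _ _ mu _ _ _ _ (EFin \o bweight p)) => //.
- by move=> n; have /integrableP[] := integrable_beta_moment n p01.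
- move=> s; rewrite /= in_itv/= => /powR01-/(_ p) /(_ (andP p01).1) /andP[a b].
  apply: cvg_EFin; first exact: nearW.
  rewrite -(mulr0 (bweight p s)); apply: cvgM; first exact: cvg_cst.
  by apply: cvg_expr; rewrite ger0_norm.
- exact: integrable_bweight.
- move=> n s; rewrite /= in_itv/= => /powR01-/(_ p) /(_ (andP p01).1) /andP[a b].
  rewrite lee_fin ger0_norm; last exact: mulr_ge0 (bweight_ge0 _ _) (exprn_ge0 _ a).
  by rewrite ler_piMr ?bweight_ge0// exprn_ile1// ltW.
Qed.

(** Since |t (1 - s)|^p = |t|^p (1 - s)^p, the bound on v splits into a power of |t| and the
    integrand of the n-th moment; the prefactor |t|^p raises the order by one. *)
Lemma sconv_bound p u v T A B n t : 0 < p <= 1 -> continuous u -> continuous v ->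
  0 <= A -> 0 <= B ->
  (forall s, `|s| <= T -> `|u s| <= A) ->
  (forall s, `|s| <= T -> `|v s| <= B * (`|s| `^ p) ^+ n) ->
  `|t| <= T -> `|sconv p u v t| <= A * B * beta_moment p n * (`|t| `^ p) ^+ n.+1.
Proof.
move=> p01 cu cv A0 B0 uA vB tT.
rewrite /sconv normrM ger0_norm ?powR_ge0// exprS mulrCA ler_wpM2l ?powR_ge0//.
apply: (le_trans (le_normr_Rintegral _ _)) => //; first exact: integrable_sconv.
pose c := A * B * (`|t| `^ p) ^+ n.
have -> : A * B * beta_moment p n * (`|t| `^ p) ^+ n =
    \int[mu]_(s in I01) (c * (bweight p s * ((1 - s) `^ p) ^+ n)).
  by rewrite RintegralZl//; [rewrite /c /beta_moment; ring|exact: integrable_beta_moment].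
apply: le_Rintegral => //.
- by have := integrable_abse (integrable_sconv t p01 cu cv).
- have : mu.-integrable I01 (fun s => c%:E * (bweight p s * ((1 - s) `^ p) ^+ n)%:E)%E.
    by apply: integrableZl => //; exact: integrable_beta_moment.
  by [].
- move=> s; rewrite /= in_itv/= => /andP[s0 s1].
  rewrite normrM ger0_norm ?bweight_ge0// mulrCA ler_wpM2l ?bweight_ge0//.
  have us : `|u (t * s)| <= A by apply: scaled_bound uA tT _; rewrite !ltW.
  have vs : `|v (t * (1 - s))| <= B * (`|t| `^ p * (1 - s) `^ p) ^+ n.
    have s1' : 0 <= 1 - s by rewrite subr_ge0 ltW.
    rewrite -powRM// -[X in `|t| * X](ger0_norm s1') -normrM; apply: vB.
    by rewrite normrM (ger0_norm s1'); apply: le_trans tT; rewrite ler_piMr// gerBl ltW.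
  rewrite normrM; apply: le_trans (ler_pM _ _ us vs) _ => //.
  by rewrite /c exprMn !mulrA.
Qed.

Lemma sconvDr p u v w t : 0 < p <= 1 -> continuous u -> continuous v -> continuous w ->
  sconv p u (fun s => v s + w s) t = sconv p u v t + sconv p u w t.
Proof.
move=> p01 cu cv cw; rewrite /sconv -mulrDr -RintegralD//; last 2 first.
- exact: integrable_sconv.
- exact: integrable_sconv.
by congr (_ * _); apply: eq_Rintegral => s _; ring.
Qed.

Lemma sconv0r p u t : sconv p u (fun=> 0) t = 0.
Proof.
rewrite /sconv; under eq_Rintegral do rewrite !mulr0.
by rewrite Rintegral_cst// mul0r mulr0.
Qed.

Definition locally_normal (x : nat -> R -> R) : Prop :=
  forall T, exists2 D : R^nat, cvgn (series D) &
    forall n t, `|t| <= T -> `|x n t| <= D n.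

Definition fseries (x : nat -> R -> R) t : R := limn (series (x ^~ t)).

Section NormalSeries.
Variable x : nat -> R -> R.
Hypothesis cx : forall n, continuous (x n).
Hypothesis nx : locally_normal x.

Lemma cvg_fseries t : series (x ^~ t) n @[n --> \oo] --> fseries x t.
Proof.
have [D cD hD] := nx `|t|.
apply: (@normed_cvg _ R^o); apply: series_le_cvg cD => n //.
- exact: normr_ge0.
- by apply: le_trans (hD n t (lexx _)).
- exact: hD.
Qed.

(** Limit m -> oo in the bound of the block from n to m by the same block of D. The right-hand side
    is free of t, so convergence is uniform on |t| <= T. *)
Lemma fseries_tail T (D : R^nat) n t : cvgn (series D) ->
  (forall n t, `|t| <= T -> `|x n t| <= D n) -> `|t| <= T ->
  `|fseries x t - series (x ^~ t) n| <= limn (series D) - series D n.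
Proof.
move=> cD hD tT.
have h1 : `|series (x ^~ t) m - series (x ^~ t) n| @[m --> \oo] -->
    `|fseries x t - series (x ^~ t) n|.
  by apply: cvg_norm; apply: cvgB; [exact: cvg_fseries|exact: cvg_cst].
have h2 : (series D m - series D n) @[m --> \oo] --> limn (series D) - series D n.
  by apply: cvgB; [exact: cD|exact: cvg_cst].
apply: ler_cvg_to h1 h2 _; exists n => // m /= nm.
rewrite !sub_series_geq//; apply: le_trans (ler_norm_sum _ _ _) _.
by apply: ler_sum => k _; exact: hD.
Qed.

Lemma continuous_partial n : continuous (fun t => series (x ^~ t) n).
Proof.
elim: n => [|n IH] t.
  rewrite /continuous_at /series/=; under eq_fun do rewrite big_geq//.
  by rewrite big_geq//; exact: cvg_cst.
have E s : series (x ^~ s) n.+1 = series (x ^~ s) n + x n s by rewrite seriesSr.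
rewrite /continuous_at E; under eq_fun do rewrite E.
by apply: cvgD; [exact: IH|exact: cx].
Qed.

Lemma continuous_fseries : continuous (fseries x).
Proof.
(* The extra 1 leaves room for a neighbourhood of t on which the tail bound is uniform. *)
move=> t; have [D cD hD] := nx (`|t| + 1).
apply/cvgrPdist_lt => e e0.
have e3 : 0 < e / 3 by rewrite divr_gt0.
have /cvgrPdist_lt/(_ _ e3)[N _ hN] : series D n @[n --> \oo] --> limn (series D) by exact: cD.
have tail s : `|s| <= `|t| + 1 -> `|fseries x s - series (x ^~ s) N| < e / 3.
  move=> sT; apply: le_lt_trans (fseries_tail N cD hD sT) _.
  by apply: le_lt_trans (hN N (leqnn _)); exact: ler_norm.
have /cvgrPdist_lt/(_ _ e3) cN := @continuous_partial N t.
near=> s.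
have st1 : `|t - s| < 1 by near: s; exact: cvgr_dist_lt.
have h3 : `|series (x ^~ t) N - series (x ^~ s) N| < e / 3 by near: s.
have st : `|s| <= `|t| + 1.
  by have := ler_normD (s - t) t; rewrite subrK distrC; lra.
have tt : `|t| <= `|t| + 1 by rewrite lerDl.
move: (tail t tt) (tail s st) h3.
rewrite !ltr_norml; move=> /andP[? ?] /andP[? ?] /andP[? ?]; apply/andP; split; lra.
Unshelve. all: by end_near. Qed.

Lemma sconv_partial p u n t : 0 < p <= 1 -> continuous u ->
  sconv p u (fun s => series (x ^~ s) n) t = series (fun k => sconv p u (x k) t) n.
Proof.
move=> p01 cu; elim: n => [|n IH].
  rewrite /series/= [RHS]big_geq// -[RHS](sconv0r p u t); congr sconv.
  by apply/funext => s; rewrite big_geq.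
rewrite seriesSr -IH -sconvDr//; last exact: continuous_partial.
by congr sconv; apply/funext => s; rewrite seriesSr.
Qed.

(** By linearity the error is [sconv p u] of the tail, and [sconv_bound] at order 0 bounds it by a
    fixed constant times the tail of the majorant. *)
Lemma cvg_sconv_fseries p u t : 0 < p <= 1 -> continuous u ->
  series (fun k => sconv p u (x k) t) n @[n --> \oo] --> sconv p u (fseries x) t.
Proof.
move=> p01 cu; have [D cD hD] := nx `|t|.
have [A A0 uA] := continuous_bounded `|t| cu.
pose c := A * beta_moment p 0 * `|t| `^ p.
have h2 : c * (limn (series D) - series D n) @[n --> \oo] --> 0.
  rewrite -(mulr0 c); apply: cvgM; first exact: cvg_cst.
  by rewrite -(subrr (limn (series D))); apply: cvgB; [exact: cvg_cst|exact: cD].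
apply/cvgrPdist_lt => e e0; move/cvgrPdist_lt : h2 => /(_ _ e0); apply: filterS => n.
rewrite sub0r normrN => /(le_lt_trans (ler_norm _)); apply: le_lt_trans.
rewrite -sconv_partial//.
have cS := @continuous_partial n.
have cX := continuous_fseries.
have cd : continuous (fun s => fseries x s - series (x ^~ s) n).
  by move=> s; apply: cvgB; [exact: cX|exact: cS].
have -> : sconv p u (fseries x) t - sconv p u (fun s => series (x ^~ s) n) t =
    sconv p u (fun s => fseries x s - series (x ^~ s) n) t.
  apply/eqP; rewrite subr_eq; apply/eqP; rewrite -sconvDr//.
  by congr sconv; apply/funext => s; rewrite subrK.
have tl s : `|s| <= `|t| -> `|fseries x s - series (x ^~ s) n| <=
    (limn (series D) - series D n) * (`|s| `^ p) ^+ 0.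
  by move=> st; rewrite expr0 mulr1; exact: fseries_tail hD st.
have B0 : 0 <= limn (series D) - series D n.
  by apply: le_trans (fseries_tail n cD hD (lexx _)).
have := sconv_bound p01 cu cd (ltW A0) B0 uA tl (lexx _).
rewrite expr1 /c => h; apply: le_trans h _.
by rewrite le_eqVlt; apply/orP; left; apply/eqP; ring.
Qed.

End NormalSeries.
End Series.

Section Neumann.
Variable R : realType.
Implicit Types p s t T : R.
Implicit Types u v w : R -> R.

(** A multiplicative recursion in place of quotients allows D to vanish, as the majorant in
    [neumann_normal] does when T = 0. *)
Lemma ratio_test (D r : R^nat) : (forall n, 0 <= D n) ->
  (forall n, D n.+1 = r n * D n) -> r n @[n --> \oo] --> 0 -> cvgn (series D).
Proof.
move=> D0 Dr r0.
have /cvgrPdist_le/(_ (2^-1)) [//|N _ hN] := r0.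
have rN n : (N <= n)%N -> r n <= 2^-1.
  by move=> /hN; rewrite sub0r normrN; apply: le_trans; exact: ler_norm.
suff h : cvgn (series (fun k => D (k + N)%N)).
  rewrite -(is_cvg_series_restrict N).
  apply/cvg_ex; exists (limn (series (fun k => D (k + N)%N))); rewrite -(cvg_shiftn N).
  have -> // : (fun n => \sum_(N <= k < n + N) D k) = series (fun k => D (k + N)%N).
  by apply/funext => n; rewrite /series/= -{1}(add0n N) big_addn addnK.
apply: (@series_le_cvg _ _ (geometric (D N) 2^-1)).
- by move=> n.
- by move=> n; rewrite mulr_ge0// exprn_ge0.
- elim=> [|n IH]; first by rewrite /geometric/= expr0 mulr1 add0n.
  rewrite addSn Dr /geometric/= exprS mulrCA.
  apply: (@le_trans _ _ (2^-1 * D (n + N)%N)); first by rewrite ler_wpM2r// rN// leq_addl.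
  by rewrite ler_wpM2l.
- by apply: is_cvg_geometric_series; rewrite ger0_norm//; lra.
Qed.

Lemma seriesSl (a : R^nat) n : series a n.+1 = a 0%N + series (fun k => a k.+1) n.
Proof. by rewrite /series/= big_nat_recl. Qed.

(** * Iteration of a complex multiplier m1 + i m2 on x + i y, in real and imaginary parts *)

Section Recursion.
Variables (p : R) (m1 m2 : R -> R) (x y : nat -> R -> R).
Hypotheses (p01 : 0 < p <= 1) (cm1 : continuous m1) (cm2 : continuous m2).
Hypotheses (cx0 : continuous (x 0%N)) (cy0 : continuous (y 0%N)).
Hypothesis xS : forall n, x n.+1 = fun t => sconv p m1 (x n) t - sconv p m2 (y n) t.
Hypothesis yS : forall n, y n.+1 = fun t => sconv p m1 (y n) t + sconv p m2 (x n) t.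

Lemma neumann_continuous n : continuous (x n) /\ continuous (y n).
Proof.
elim: n => [//|n [cx cy]]; rewrite xS yS; split => t.
  by apply: cvgB; exact: continuous_sconv.
by apply: cvgD; exact: continuous_sconv.
Qed.

(** The recursion mixes x and y, so both are estimated together and share one majorant. *)
Lemma neumann_normal T : exists2 D : R^nat, cvgn (series D) &
  forall n t, `|t| <= T -> `|x n t| <= D n /\ `|y n t| <= D n.
Proof.
have [A1 A10 hA1] := continuous_bounded T cm1.
have [A2 A20 hA2] := continuous_bounded T cm2.
have [A3 A30 hA3] := continuous_bounded T cx0.
have [A4 A40 hA4] := continuous_bounded T cy0.
pose M := A1 + A2 + A3 + A4.
have M0 : 0 <= M by rewrite /M; lra.
have hM1 t : `|t| <= T -> `|m1 t| <= M by move=> /hA1 h; rewrite /M; lra.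
have hM2 t : `|t| <= T -> `|m2 t| <= M by move=> /hA2 h; rewrite /M; lra.
(* M bounds the multipliers and the starting terms; 2 counts the two applications of [sconv] in each
   step, and the moment is the gain of [sconv_bound]. *)
pose C := fix C n := if n is n'.+1 then 2 * M * beta_moment p n' * C n' else M.
have C0 n : 0 <= C n.
  by elim: n => //= n IH; rewrite mulr_ge0// mulr_ge0 ?beta_moment_ge0// mulr_ge0.
have bnd n t : `|t| <= T -> `|x n t| <= C n * (`|t| `^ p) ^+ n /\
                           `|y n t| <= C n * (`|t| `^ p) ^+ n.
  elim: n t => [|n IH] t tT.
    rewrite expr0 mulr1/=; have := hA3 _ tT; have := hA4 _ tT.
    by split; rewrite /M; lra.
  have [cx cy] := neumann_continuous n.
  have bx s := fun sT : `|s| <= T => (IH s sT).1.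
  have by_ s := fun sT : `|s| <= T => (IH s sT).2.
  have h1 := sconv_bound p01 cm1 cx M0 (C0 n) hM1 bx tT.
  have h2 := sconv_bound p01 cm2 cx M0 (C0 n) hM2 bx tT.
  have h3 := sconv_bound p01 cm1 cy M0 (C0 n) hM1 by_ tT.
  have h4 := sconv_bound p01 cm2 cy M0 (C0 n) hM2 by_ tT.
  have E : C n.+1 * (`|t| `^ p) ^+ n.+1 =
      M * C n * beta_moment p n * (`|t| `^ p) ^+ n.+1 +
      M * C n * beta_moment p n * (`|t| `^ p) ^+ n.+1.
    by rewrite /=; ring.
  rewrite E xS yS; split.
    by apply: le_trans (ler_normB _ _) _; exact: lerD.
  by apply: le_trans (ler_normD _ _) _; exact: lerD.
have [p0 _] := andP p01.
exists (fun n => C n * (`|T| `^ p) ^+ n).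
  apply: (@ratio_test _ (fun n => 2 * M * beta_moment p n * `|T| `^ p)).
  - by move=> n; rewrite mulr_ge0// exprn_ge0// powR_ge0.
  - by move=> n /=; rewrite exprS; ring.
  - have := cvg_beta_moment p01 => h.
    rewrite -(mul0r (`|T| `^ p)) -(mulr0 (2 * M)).
    apply: cvgM; last exact: cvg_cst.
    by apply: cvgM; [exact: cvg_cst|exact: h].
move=> n t tT; have [h1 h2] := bnd n t tT.
have le : C n * (`|t| `^ p) ^+ n <= C n * (`|T| `^ p) ^+ n.
  rewrite ler_wpM2l// lerXn2r ?nnegrE ?powR_ge0//.
  by rewrite ge0_ler_powR ?nnegrE ?(ltW p0)//; apply: le_trans tT _; exact: ler_norm.
by split; [exact: le_trans h1 le|exact: le_trans h2 le].
Qed.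

Lemma neumann_normalx : locally_normal x.
Proof. by move=> T; have [D cD h] := neumann_normal T; exists D => // n t /(h n)[]. Qed.

Lemma neumann_normaly : locally_normal y.
Proof. by move=> T; have [D cD h] := neumann_normal T; exists D => // n t /(h n)[]. Qed.

Let cx n : continuous (x n). Proof. by have [] := neumann_continuous n. Qed.
Let cy n : continuous (y n). Proof. by have [] := neumann_continuous n. Qed.

(** Once the first term is split off, the recursion writes the remaining series as termwise images
    under [sconv], and [cvg_sconv_fseries] sums these. *)
Lemma neumann_eqx t :
  fseries x t = x 0%N t + (sconv p m1 (fseries x) t - sconv p m2 (fseries y) t).
Proof.
have h := @cvg_fseries _ x neumann_normalx t.
rewrite -(cvg_shiftS (series (x ^~ t))) in h.
rewrite -[LHS](cvg_lim (@Rhausdorff R) h); apply: cvg_lim; first exact: Rhausdorff.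
have -> : (fun n => series (x ^~ t) n.+1) = (fun n => x 0%N t +
    (series (fun k => sconv p m1 (x k) t) n - series (fun k => sconv p m2 (y k) t) n)).
  apply/funext => n; rewrite seriesSl; congr (_ + _).
  by rewrite /series/= -sumrB; apply: eq_bigr => k _; rewrite xS.
apply: cvgD; first exact: cvg_cst.
apply: cvgB.
  exact: (cvg_sconv_fseries cx neumann_normalx).
exact: (cvg_sconv_fseries cy neumann_normaly).
Qed.

Lemma neumann_eqy t :
  fseries y t = y 0%N t + (sconv p m1 (fseries y) t + sconv p m2 (fseries x) t).
Proof.
have h := @cvg_fseries _ y neumann_normaly t.
rewrite -(cvg_shiftS (series (y ^~ t))) in h.
rewrite -[LHS](cvg_lim (@Rhausdorff R) h); apply: cvg_lim; first exact: Rhausdorff.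
have -> : (fun n => series (y ^~ t) n.+1) = (fun n => y 0%N t +
    (series (fun k => sconv p m1 (y k) t) n + series (fun k => sconv p m2 (x k) t) n)).
  apply/funext => n; rewrite seriesSl; congr (_ + _).
  by rewrite /series/= -big_split/=; apply: eq_bigr => k _; rewrite yS.
apply: cvgD; first exact: cvg_cst.
apply: cvgD.
  exact: (cvg_sconv_fseries cy neumann_normaly).
exact: (cvg_sconv_fseries cx neumann_normalx).
Qed.

End Recursion.
End Neumann.

(** * Complex convolution *)

Section ComplexTopology.
Variable R : realType.

Lemma complex_eq (z w : R[i]) : complex.Re z = complex.Re w ->
  complex.Im z = complex.Im w -> z = w.
Proof. by case: z w => [a b] [c d] /= -> ->. Qed.

Lemma complex_ReM (z w : R[i]) :
  complex.Re (z * w) = complex.Re z * complex.Re w - complex.Im z * complex.Im w.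
Proof. by case: z w => [a b] [c d]. Qed.

Lemma complex_ImM (z w : R[i]) :
  complex.Im (z * w) = complex.Re z * complex.Im w + complex.Im z * complex.Re w.
Proof. by case: z w => [a b] [c d]. Qed.

Lemma complex_ReD (z w : R[i]) : complex.Re (z + w) = complex.Re z + complex.Re w.
Proof. by case: z w => [a b] [c d]. Qed.

Lemma complex_ImD (z w : R[i]) : complex.Im (z + w) = complex.Im z + complex.Im w.
Proof. by case: z w => [a b] [c d]. Qed.

Lemma normc_le_ReIm (z : R[i]) :
  `|z| <= (`|complex.Re z| + `|complex.Im z|)%:C.
Proof.
rewrite normc_def lecR; set a := complex.Re z; set b := complex.Im z.
rewrite -[leRHS]ger0_norm ?addr_ge0// -sqrtr_sqr ler_wsqrtr//.
rewrite sqrrD !real_normK ?num_real// lerD2r lerDl mulrn_wge0//.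
Qed.

Lemma normc_ge_Im (z : R[i]) : `|complex.Im z|%:C <= `|z|.
Proof.
rewrite normc_def lecR -sqrtr_sqr ler_wsqrtr// lerDr sqr_ge0//.
Qed.

Lemma cvg_complex (T : Type) (F : set_system T) (FF : Filter F) (u v : T -> R) (a b : R) :
  u @ F --> a -> v @ F --> b ->
  (fun t => (u t +i* v t : R[i]^o)) @ F --> (a +i* b : R[i]^o).
Proof.
move=> /cvgrPdist_lt ua /cvgrPdist_lt vb; apply/cvgrPdist_lt => -[e i].
(* In [R[i]] the relation 0 < z forces z to be real, so the tolerance is a positive real number. *)
rewrite ltcE/= => /andP[/eqP -> e0].
have e2 : 0 < e / 2 by rewrite divr_gt0.
apply: filterS2 (ua _ e2) (vb _ e2) => t ut vt.
apply: le_lt_trans (normc_le_ReIm _) _; rewrite ltcR/=.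
by have := ltrD ut vt; rewrite -splitr.
Qed.

Lemma cvg_Re (T : Type) (F : set_system T) (FF : Filter F) (f : T -> R[i]^o) (z : R[i]^o) :
  f @ F --> z -> (fun t => complex.Re (f t)) @ F --> complex.Re z.
Proof.
move=> /cvgrPdist_lt fz; apply/cvgrPdist_lt => e e0.
have ec : (0 : R[i]) < e%:C by rewrite ltcR.
apply: filterS (fz _ ec) => t h; rewrite -ltcR; apply: le_lt_trans h.
by apply: le_trans (normc_ge_Re _); rewrite lecR; case: (z) (f t) => [a b] [c d].
Qed.

Lemma cvg_Im (T : Type) (F : set_system T) (FF : Filter F) (f : T -> R[i]^o) (z : R[i]^o) :
  f @ F --> z -> (fun t => complex.Im (f t)) @ F --> complex.Im z.
Proof.
move=> /cvgrPdist_lt fz; apply/cvgrPdist_lt => e e0.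
have ec : (0 : R[i]) < e%:C by rewrite ltcR.
apply: filterS (fz _ ec) => t h; rewrite -ltcR; apply: le_lt_trans h.
by apply: le_trans (normc_ge_Im _); rewrite lecR; case: (z) (f t) => [a b] [c d].
Qed.

End ComplexTopology.

Section ComplexConvolution.
Variable R : realType.
Implicit Types p q t : R.
Implicit Types f g h : cfun R.
Local Notation reC f := (fun t => complex.Re (f t)).
Local Notation imC f := (fun t => complex.Im (f t)).

Definition cpowerlike p f := rpowerlike p (reC f) /\ rpowerlike p (imC f).

(** The absolute value maps the line continuously into the half-line; composing with it extends f
    without changing it at positive points. *)
Lemma continuous_fold_normr f : {within `[0, +oo[, continuous f} ->
  continuous (fun t : R => f `|t|).
Proof.
move=> /subspace_continuousP cf t.
apply: (@cvg_comp _ _ _ (@Num.norm R R) f _ (within `[0, +oo[ (nbhs `|t|))); last first.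
  by apply: cf; rewrite /= in_itv/= andbT.
move=> A; rewrite /within /= => hA.
have h : nbhs t (fun s : R => `|s| \in `[0, +oo[ -> A `|s|).
  exact: (@norm_continuous R R t _ hA).
by apply: filterS h => s; apply; rewrite in_itv/= andbT.
Qed.

Lemma powerlikeP p f : powerlike p f <-> cpowerlike p f.
Proof.
split=> [[f1 cf1 fE]|[[u cu uE] [v cv vE]]].
  have cf := continuous_fold_normr cf1; split.
  - exists (fun t => complex.Re (f1 `|t|)); first by move=> t; apply: cvg_Re; exact: cf.
    by move=> t t0; rewrite fE// complex_ReM/= mul0r subr0 gtr0_norm.
  - exists (fun t => complex.Im (f1 `|t|)); first by move=> t; apply: cvg_Im; exact: cf.
    by move=> t t0; rewrite fE// complex_ImM/= mul0r addr0 gtr0_norm.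
exists (fun t => u t +i* v t).
  by apply: continuous_subspaceT => t; apply: cvg_complex; [exact: cu|exact: cv].
move=> t t0; apply: complex_eq; first by rewrite uE// complex_ReM/= mul0r subr0.
by rewrite vE// complex_ImM/= mul0r addr0.
Qed.

Lemma cpowerlike_le p q f : p <= q -> cpowerlike q f -> cpowerlike p f.
Proof. by move=> pq [fr fi]; split; exact: rpowerlike_lt pq _. Qed.

Lemma Cm1_cpowerlike p f : 0 < p -> cpowerlike p f -> Cm1 f.
Proof. by move=> p0 /powerlikeP; exists p. Qed.

(** Allowing every q below p lets [Cm1_common] take a minimum. *)
Lemma Cm1_le f : Cm1 f -> exists2 p, 0 < p <= 1 & forall q, q <= p -> cpowerlike q f.
Proof.
move=> [p p0 /powerlikeP pf]; exists (Num.min p 1).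
  by rewrite lt_min p0 ltr01 ge_min lexx orbT.
by move=> q; rewrite le_min => /andP[qp _]; exact: cpowerlike_le pf.
Qed.

(** Three functions are enough for the ring laws; those with two repeat an argument. *)
Lemma Cm1_common f g h : Cm1 f -> Cm1 g -> Cm1 h ->
  exists p, [/\ 0 < p <= 1, cpowerlike p f, cpowerlike p g & cpowerlike p h].
Proof.
move=> /Cm1_le[p /andP[p0 p1] hp] /Cm1_le[q /andP[q0 _] hq] /Cm1_le[r /andP[r0 _] hr].
exists (Num.min p (Num.min q r)); split.
- by rewrite !lt_min p0 q0 r0 ge_min p1.
- by apply: hp; rewrite ge_min lexx.
- by apply: hq; rewrite !ge_min lexx orbT.
- by apply: hr; rewrite !ge_min lexx !orbT.
Qed.

Lemma Re_conv p f g t : 0 < p <= 1 -> cpowerlike p f -> cpowerlike p g -> 0 < t ->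
  complex.Re (conv f g t) = rconv (reC f) (reC g) t - rconv (imC f) (imC g) t.
Proof.
move=> p01 [fr fi] [gr gi] t0; rewrite /Defs.conv /cintegral/= /rconv -RintegralB//.
- by apply: eq_Rintegral => s _; rewrite complex_ReM.
- exact: (integrable_rconv p01 fr gr t0).
- exact: (integrable_rconv p01 fi gi t0).
Qed.

Lemma Im_conv p f g t : 0 < p <= 1 -> cpowerlike p f -> cpowerlike p g -> 0 < t ->
  complex.Im (conv f g t) = rconv (reC f) (imC g) t + rconv (imC f) (reC g) t.
Proof.
move=> p01 [fr fi] [gr gi] t0; rewrite /Defs.conv /cintegral/= /rconv -RintegralD//.
- by apply: eq_Rintegral => s _; rewrite complex_ImM.
- exact: (integrable_rconv p01 fr gi t0).
- exact: (integrable_rconv p01 fi gr t0).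
Qed.

Lemma eq_rpowerlike p (f g : R -> R) : (forall t, 0 < t -> f t = g t) ->
  rpowerlike p f -> rpowerlike p g.
Proof. by move=> fg [u cu fE]; exists u => // t t0; rewrite -fg// fE. Qed.

Lemma cpowerlike_conv p f g : 0 < p <= 1 -> cpowerlike p f -> cpowerlike p g ->
  cpowerlike p (conv f g).
Proof.
move=> p01 pf pg; have [[fr fi] [gr gi]] := (pf, pg); split.
  apply: (@eq_rpowerlike p (fun t => rconv (reC f) (reC g) t - rconv (imC f) (imC g) t)).
    by move=> t t0; rewrite (Re_conv p01 pf pg t0).
  by apply: rpowerlikeB; exact: rpowerlike_rconv.
apply: (@eq_rpowerlike p (fun t => rconv (reC f) (imC g) t + rconv (imC f) (reC g) t)).
  by move=> t t0; rewrite (Im_conv p01 pf pg t0).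
by apply: rpowerlikeD; exact: rpowerlike_rconv.
Qed.

Lemma cpowerlikeD p f g : cpowerlike p f -> cpowerlike p g ->
  cpowerlike p (fun t => f t + g t).
Proof.
move=> [fr fi] [gr gi]; split.
  by apply: eq_rpowerlike (rpowerlikeD fr gr) => t _; rewrite complex_ReD.
by apply: eq_rpowerlike (rpowerlikeD fi gi) => t _; rewrite complex_ImD.
Qed.

Lemma cpowerlikeZ p (a : R[i]) f : cpowerlike p f -> cpowerlike p (fun t => a * f t).
Proof.
move=> [fr fi]; split.
  apply: eq_rpowerlike (rpowerlikeB (rpowerlikeZ (complex.Re a) fr)
    (rpowerlikeZ (complex.Im a) fi)) => t _; by rewrite complex_ReM.
apply: eq_rpowerlike (rpowerlikeD (rpowerlikeZ (complex.Re a) fi)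
  (rpowerlikeZ (complex.Im a) fr)) => t _; by rewrite complex_ImM.
Qed.

Lemma Cm1_conv f g : Cm1 f -> Cm1 g -> Cm1 (conv f g).
Proof.
move=> cf cg; have [p [p01 pf pg _]] := Cm1_common cf cg cg.
exact: (Cm1_cpowerlike (andP p01).1 (cpowerlike_conv p01 pf pg)).
Qed.

Lemma Cm1D f g : Cm1 f -> Cm1 g -> Cm1 (fun t => f t + g t).
Proof.
move=> cf cg; have [p [p01 pf pg _]] := Cm1_common cf cg cg.
exact: (Cm1_cpowerlike (andP p01).1 (cpowerlikeD pf pg)).
Qed.

Lemma Cm1Z (a : R[i]) f : Cm1 f -> Cm1 (fun t => a * f t).
Proof.
move=> cf; have [p [p01 pf _ _]] := Cm1_common cf cf cf.
exact: (Cm1_cpowerlike (andP p01).1 (cpowerlikeZ a pf)).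
Qed.

Lemma eq_conv f f' g g' : eq_pos f f' -> eq_pos g g' -> eq_pos (conv f g) (conv f' g').
Proof.
move=> ff gg t t0; have h s : s \in `]0, t[%classic ->
    f s * g (t - s) = f' s * g' (t - s).
  by rewrite inE/= in_itv/= => /andP[s0 st]; rewrite ff// gg// subr_gt0.
by rewrite /Defs.conv /cintegral; congr (_ +i* _); apply: eq_Rintegral => s /h ->.
Qed.

Lemma convC f g : Cm1 f -> Cm1 g -> eq_pos (conv f g) (conv g f).
Proof.
move=> cf cg t t0; have [p [p01 pf pg _]] := Cm1_common cf cg cg.
have [[fr fi] [gr gi]] := (pf, pg).
apply: complex_eq; rewrite ?(Re_conv p01)// ?(Im_conv p01)//.
  by rewrite (rconvC t fr gr) (rconvC t fi gi).
by rewrite (rconvC t fr gi) (rconvC t fi gr) addrC.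
Qed.

Lemma convDl f1 f2 g : Cm1 f1 -> Cm1 f2 -> Cm1 g ->
  eq_pos (conv (fun t => f1 t + f2 t) g) (fun t => conv f1 g t + conv f2 g t).
Proof.
move=> cf1 cf2 cg t t0; have [p [p01 pf1 pf2 pg]] := Cm1_common cf1 cf2 cg.
have [[f1r f1i] [f2r f2i] [gr gi]] := And3 pf1 pf2 pg.
have pD := cpowerlikeD pf1 pf2.
have eRe := fun (s : R) (_ : 0 < s < t) => complex_ReD (f1 s) (f2 s).
have eIm := fun (s : R) (_ : 0 < s < t) => complex_ImD (f1 s) (f2 s).
apply: complex_eq; rewrite ?complex_ReD ?complex_ImD ?(Re_conv p01)// ?(Im_conv p01)//.
  rewrite (eq_rconv (g := reC g) eRe (fun _ _ => erefl)) (rconvDl p01)//.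
  rewrite (eq_rconv (g := imC g) eIm (fun _ _ => erefl)) (rconvDl p01)//; ring.
rewrite (eq_rconv (g := imC g) eRe (fun _ _ => erefl)) (rconvDl p01)//.
rewrite (eq_rconv (g := reC g) eIm (fun _ _ => erefl)) (rconvDl p01)//; ring.
Qed.

Lemma convZl (a : R[i]) f g : Cm1 f -> Cm1 g ->
  eq_pos (conv (fun t => a * f t) g) (fun t => a * conv f g t).
Proof.
move=> cf cg t t0; have [p [p01 pf pg _]] := Cm1_common cf cg cg.
have [[fr fi] [gr gi]] := (pf, pg).
have pZ := cpowerlikeZ a pf.
have [arr aii] := (rpowerlikeZ (complex.Re a) fr, rpowerlikeZ (complex.Im a) fi).
have [ari air] := (rpowerlikeZ (complex.Re a) fi, rpowerlikeZ (complex.Im a) fr).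
have eRe := fun (s : R) (_ : 0 < s < t) => complex_ReM a (f s).
have eIm := fun (s : R) (_ : 0 < s < t) => complex_ImM a (f s).
apply: complex_eq; rewrite ?complex_ReM ?complex_ImM ?(Re_conv p01)// ?(Im_conv p01)//.
  rewrite (eq_rconv (g := reC g) eRe (fun _ _ => erefl)) (rconvBl p01)//.
  rewrite (eq_rconv (g := imC g) eIm (fun _ _ => erefl)) (rconvDl p01)//.
  by rewrite !(rconvZl _ p01)//; ring.
rewrite (eq_rconv (g := imC g) eRe (fun _ _ => erefl)) (rconvBl p01)//.
rewrite (eq_rconv (g := reC g) eIm (fun _ _ => erefl)) (rconvDl p01)//.
by rewrite !(rconvZl _ p01)//; ring.
Qed.

Lemma convA f g h : Cm1 f -> Cm1 g -> Cm1 h ->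
  eq_pos (conv f (conv g h)) (conv (conv f g) h).
Proof.
move=> cf cg ch t t0; have [p [p01 pf pg ph]] := Cm1_common cf cg ch.
have [[fr fi] [gr gi] [hr hi]] := And3 pf pg ph.
have pgh := cpowerlike_conv p01 pg ph; have pfg := cpowerlike_conv p01 pf pg.
have rgh := fun (s : R) (st : 0 < s < t) => Re_conv p01 pg ph (andP st).1.
have igh := fun (s : R) (st : 0 < s < t) => Im_conv p01 pg ph (andP st).1.
have rfg := fun (s : R) (st : 0 < s < t) => Re_conv p01 pf pg (andP st).1.
have ifg := fun (s : R) (st : 0 < s < t) => Im_conv p01 pf pg (andP st).1.
have c (f' g' : R -> R) := @rpowerlike_rconv R p f' g' p01.
apply: complex_eq; rewrite ?(Re_conv p01)// ?(Im_conv p01)//.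
  rewrite (eq_rconv (f := reC f) (fun _ _ => erefl) rgh)
    (rconvBr p01 fr (c _ _ gr hr) (c _ _ gi hi))//.
  rewrite (eq_rconv (f := imC f) (fun _ _ => erefl) igh)
    (rconvDr p01 fi (c _ _ gr hi) (c _ _ gi hr))//.
  rewrite (eq_rconv (g := reC h) rfg (fun _ _ => erefl))
    (rconvBl p01 (c _ _ fr gr) (c _ _ fi gi) hr)//.
  rewrite (eq_rconv (g := imC h) ifg (fun _ _ => erefl))
    (rconvDl p01 (c _ _ fr gi) (c _ _ fi gr) hi)//.
  rewrite (rconvA p01 fr gr hr t0) (rconvA p01 fr gi hi t0).
  by rewrite (rconvA p01 fi gr hi t0) (rconvA p01 fi gi hr t0); ring.
rewrite (eq_rconv (f := reC f) (fun _ _ => erefl) igh)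
    (rconvDr p01 fr (c _ _ gr hi) (c _ _ gi hr))//.
rewrite (eq_rconv (f := imC f) (fun _ _ => erefl) rgh)
    (rconvBr p01 fi (c _ _ gr hr) (c _ _ gi hi))//.
rewrite (eq_rconv (g := imC h) rfg (fun _ _ => erefl))
    (rconvBl p01 (c _ _ fr gr) (c _ _ fi gi) hi)//.
rewrite (eq_rconv (g := reC h) ifg (fun _ _ => erefl))
    (rconvDl p01 (c _ _ fr gi) (c _ _ fi gr) hr)//.
rewrite (rconvA p01 fr gr hi t0) (rconvA p01 fr gi hr t0).
by rewrite (rconvA p01 fi gr hr t0) (rconvA p01 fi gi hi t0); ring.
Qed.

Lemma conv1_eq0 h : Cm1 h -> eq_pos (conv (fun=> 1) h) (fun=> 0) -> eq_pos h (fun=> 0).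
Proof.
move=> /Cm1_le[p p01 /(_ p (lexx _)) ph] h0 t t0; have [hr hi] := ph.
have [p0 p1] := andP p01.
have c1 : cpowerlike p (fun=> 1) by split; exact: rpowerlike_cst.
have r0 (g : R -> R) s : rconv (fun=> 0) g s = 0.
  rewrite /rconv; under eq_Rintegral do rewrite mul0r.
  by rewrite Rintegral_cst// mul0r.
apply: complex_eq.
  apply: (rconv1_eq0 p01 hr) t0 => s s0.
  by have := congr1 (@complex.Re R) (h0 s s0); rewrite (Re_conv p01 c1 ph)// r0 subr0.
apply: (rconv1_eq0 p01 hi) t0 => s s0.
by have := congr1 (@complex.Im R) (h0 s s0); rewrite (Im_conv p01 c1 ph)// r0 addr0.
Qed.

End ComplexConvolution.

(** * Convergence of the series of l and its resolvent equation *)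

Section ResolventSeries.
Variable R : realType.
Implicit Types p q t : R.
Implicit Types f g h kappa : cfun R.
Local Notation reC f := (fun t => complex.Re (f t)).
Local Notation imC f := (fun t => complex.Im (f t)).

(** The right-hand factor is the complex bilinear operator in components, in the very shape of the
    recursion of [Recursion]. *)
Lemma Re_conv_scaled p f g u1 u2 v1 v2 t : 0 < p <= 1 ->
  continuous u1 -> continuous u2 -> continuous v1 -> continuous v2 ->
  (forall t, 0 < t -> f t = (t `^ (p - 1))%:C * (u1 t +i* u2 t)) ->
  (forall t, 0 < t -> g t = (t `^ (p - 1))%:C * (v1 t +i* v2 t)) -> 0 < t ->
  conv f g t = (t `^ (p - 1))%:C *
    ((sconv p u1 v1 t - sconv p u2 v2 t) +i* (sconv p u1 v2 t + sconv p u2 v1 t)).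
Proof.
move=> p01 cu1 cu2 cv1 cv2 fE gE t0.
have fr s : 0 < s -> complex.Re (f s) = s `^ (p - 1) * u1 s.
  by move=> s0; rewrite fE// complex_ReM/= mul0r subr0.
have fi s : 0 < s -> complex.Im (f s) = s `^ (p - 1) * u2 s.
  by move=> s0; rewrite fE// complex_ImM/= mul0r addr0.
have gr s : 0 < s -> complex.Re (g s) = s `^ (p - 1) * v1 s.
  by move=> s0; rewrite gE// complex_ReM/= mul0r subr0.
have gi s : 0 < s -> complex.Im (g s) = s `^ (p - 1) * v2 s.
  by move=> s0; rewrite gE// complex_ImM/= mul0r addr0.
have pf : cpowerlike p f by split; [exists u1|exists u2].
have pg : cpowerlike p g by split; [exists v1|exists v2].
apply: complex_eq.
  rewrite (Re_conv p01 pf pg t0) complex_ReM/= mul0r subr0 mulrBr.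
  by rewrite (rconv_scaled p01 cu1 cv1 fr gr t0) (rconv_scaled p01 cu2 cv2 fi gi t0).
rewrite (Im_conv p01 pf pg t0) complex_ImM/= mul0r addr0 mulrDr.
by rewrite (rconv_scaled p01 cu1 cv2 fr gi t0) (rconv_scaled p01 cu2 cv1 fi gr t0).
Qed.

Lemma Cm1_convpow kappa n : Cm1 kappa -> Cm1 (convpow kappa n.+1).
Proof. by move=> ck; elim: n => [//|n IH]; exact: Cm1_conv. Qed.

Lemma convZr (a : R[i]) f g : Cm1 f -> Cm1 g ->
  eq_pos (conv f (fun t => a * g t)) (fun t => a * conv f g t).
Proof.
move=> cf cg t t0; rewrite (convC cf (Cm1Z a cg) t0) (convZl a cg cf t0).
by rewrite (convC cg cf t0).
Qed.

Lemma lser_resolvent kappa (lambda : R[i]) : Cm1 kappa ->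
  [/\ forall t : R, 0 < t -> cvgn (lpartial kappa lambda t),
      Cm1 (lser kappa lambda) &
      eq_pos (lser kappa lambda)
        (fun t => kappa t + conv (fun s => lambda * kappa s) (lser kappa lambda) t)].
Proof.
move=> ck; have [p p01 /(_ p (lexx _)) [[u cu uE] [v cv vE]]] := Cm1_le ck.
have [p0 p1] := andP p01.
pose lr := complex.Re lambda; pose li := complex.Im lambda.
(* m1 + i m2 = lambda (u + i v) is the continuous factor of lambda kappa. *)
pose m1 (t : R) := lr * u t - li * v t; pose m2 (t : R) := lr * v t + li * u t.
have cm1 : continuous m1.
  by move=> t; apply: cvgB; apply: cvgM; [exact: cvg_cst|exact: cu|exact: cvg_cst|exact: cv].
have cm2 : continuous m2.
  by move=> t; apply: cvgD; apply: cvgM; [exact: cvg_cst|exact: cv|exact: cvg_cst|exact: cu].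
have kE t : 0 < t -> kappa t = (t `^ (p - 1))%:C * (u t +i* v t).
  move=> t0; apply: complex_eq; rewrite ?complex_ReM ?complex_ImM/= mul0r;
    by rewrite ?subr0 ?addr0 ?uE ?vE.
have mE t : 0 < t -> lambda * kappa t = (t `^ (p - 1))%:C * (m1 t +i* m2 t).
  move=> t0; rewrite kE// mulrCA; congr (_ * _).
  by apply: complex_eq; rewrite ?complex_ReM ?complex_ImM/= /m1 /m2 /lr /li.
(* The two sequences are mutually recursive, hence one fixpoint on pairs, started at the factor u +
   i v of kappa. *)
pose xy := fix xy n : (R -> R) * (R -> R) := if n is n'.+1 then
   (fun t => sconv p m1 (xy n').1 t - sconv p m2 (xy n').2 t,
    fun t => sconv p m1 (xy n').2 t + sconv p m2 (xy n').1 t) else (u, v).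
pose x n := (xy n).1; pose y n := (xy n).2.
have xS n : x n.+1 = fun t => sconv p m1 (x n) t - sconv p m2 (y n) t by [].
have yS n : y n.+1 = fun t => sconv p m1 (y n) t + sconv p m2 (x n) t by [].
have cx0 : continuous (x 0%N) := cu.
have cy0 : continuous (y 0%N) := cv.
have cxy := neumann_continuous p01 cm1 cm2 cx0 cy0 xS yS.
have nx := neumann_normalx p01 cm1 cm2 cx0 cy0 xS yS.
have ny := neumann_normaly p01 cm1 cm2 cx0 cy0 xS yS.
have eqx := neumann_eqx p01 cm1 cm2 cx0 cy0 xS yS.
have eqy := neumann_eqy p01 cm1 cm2 cx0 cy0 xS yS.
(* Each new factor kappa brings one lambda, so every term is the convolution of lambda kappa with
   the preceding one. *)
have term n t : 0 < t -> lambda ^+ n * convpow kappa n.+1 t =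
    (t `^ (p - 1))%:C * (x n t +i* y n t).
  elim: n t => [|n IH] t t0; first by rewrite expr0 mul1r; exact: kE.
  have cn := Cm1_convpow n ck.
  have := Re_conv_scaled p01 cm1 cm2 (cxy n).1 (cxy n).2 mE IH t0.
  rewrite (convZl lambda ck (Cm1Z _ cn) t0) (convZr _ ck cn t0) mulrA -exprS => ->.
  by [].
have limE t : 0 < t -> lpartial kappa lambda t n @[n --> \oo] -->
    ((t `^ (p - 1))%:C * (fseries x t +i* fseries y t) : R[i]^o).
  (* The sum in [lpartial] starts at j = 1, while x and y are indexed from 0; the shift aligns
     them. *)
  move=> t0; rewrite -(cvg_shiftS (lpartial kappa lambda t)).
  have -> : (fun n => lpartial kappa lambda t n.+1) =
      (fun n => (t `^ (p - 1) * series (x ^~ t) n) +i* (t `^ (p - 1) * series (y ^~ t) n)).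
    apply/funext => n; rewrite /lpartial big_add1/=.
    elim: n => [|n IH].
      by rewrite big_geq// /series/= !big_geq// !mulr0.
    rewrite big_nat_recr//= IH term//.
    rewrite !seriesSr !mulrDr; apply: complex_eq.
      by rewrite complex_ReD complex_ReM/= mul0r subr0.
    by rewrite complex_ImD complex_ImM/= mul0r addr0.
  have -> : (t `^ (p - 1))%:C * (fseries x t +i* fseries y t) =
      (t `^ (p - 1) * fseries x t) +i* (t `^ (p - 1) * fseries y t).
    by apply: complex_eq; rewrite ?complex_ReM ?complex_ImM/= mul0r ?subr0 ?addr0.
  apply: cvg_complex; (apply: cvgM; first exact: cvg_cst); exact: cvg_fseries.
have lE t : 0 < t -> lser kappa lambda t =
    (t `^ (p - 1))%:C * (fseries x t +i* fseries y t).
  by move=> t0; apply: cvg_lim; [exact: norm_hausdorff|exact: limE].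
have cX := continuous_fseries (fun n => (cxy n).1) nx.
have cY := continuous_fseries (fun n => (cxy n).2) ny.
split.
- by move=> t t0; apply/cvg_ex; eexists; exact: limE.
- apply: (Cm1_cpowerlike p0); split.
    by exists (fseries x) => // t t0; rewrite lE// complex_ReM/= mul0r subr0.
  by exists (fseries y) => // t t0; rewrite lE// complex_ImM/= mul0r addr0.
- move=> t t0; rewrite (Re_conv_scaled p01 cm1 cm2 cX cY mE lE t0) lE// kE// -mulrDr.
  by congr (_ * _); apply: complex_eq;
    rewrite ?complex_ReD ?complex_ImD/= ?[in LHS]eqx ?[in LHS]eqy.
Qed.

End ResolventSeries.

(** * Convolution quotients *)

Section Quotients.
Variable R : realType.
Implicit Types f g h : cfun R.
Implicit Types a b c : frac R.

Lemma eq_pos_sym f g : eq_pos f g -> eq_pos g f.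
Proof. by move=> fg t t0; rewrite fg. Qed.

Lemma eq_pos_trans g f h : eq_pos f g -> eq_pos g h -> eq_pos f h.
Proof. by move=> fg gh t t0; rewrite fg// gh. Qed.

Lemma eq_convl f f' g : eq_pos f f' -> eq_pos (conv f g) (conv f' g).
Proof. by move=> ff; exact: eq_conv. Qed.

Lemma eq_convr f g g' : eq_pos g g' -> eq_pos (conv f g) (conv f g').
Proof. by move=> gg; exact: eq_conv. Qed.

Lemma convDr f g1 g2 : Cm1 f -> Cm1 g1 -> Cm1 g2 ->
  eq_pos (conv f (fun t => g1 t + g2 t)) (fun t => conv f g1 t + conv f g2 t).
Proof.
move=> cf cg1 cg2 t t0; rewrite (convC cf (Cm1D cg1 cg2) t0) (convDl cg1 cg2 cf t0).
by rewrite (convC cf cg1 t0) (convC cf cg2 t0).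
Qed.

Lemma convAC f g h : Cm1 f -> Cm1 g -> Cm1 h ->
  eq_pos (conv (conv f g) h) (conv (conv f h) g).
Proof.
move=> cf cg ch; apply: eq_pos_trans (eq_pos_sym (convA cf cg ch)) _.
by apply: eq_pos_trans (eq_convr _ (convC cg ch)) _; exact: convA.
Qed.

Lemma conv0l h : eq_pos (conv (fun=> 0) h) (fun=> 0).
Proof.
move=> t _; have E : (fun s : R => (0 : R[i]^o) * h (t - s)) = fun=> 0.
  by apply/funext => s; rewrite mul0r.
by rewrite /Defs.conv E /cintegral/= !Rintegral_cst// mul0r.
Qed.

(** Local substitute for the absence of zero divisors, established only for the functions that serve
    as denominators. *)
Definition cancellable f : Prop := forall h h', Cm1 h -> Cm1 h' ->
  eq_pos (conv f h) (conv f h') -> eq_pos h h'.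

Lemma Cm1_cst (z : R[i]) : Cm1 (fun=> z).
Proof.
apply: (@Cm1_cpowerlike _ 1) => //; split; exact: rpowerlike_cst.
Qed.

Lemma cancellable_one : cancellable (fun=> 1).
Proof.
move=> h h' ch ch' e t t0; have c1 := Cm1_cst 1.
have cN := Cm1Z (-1) ch'.
have d0 : eq_pos (conv (fun=> 1) (fun s => h s + -1 * h' s)) (fun=> 0).
  move=> s s0; rewrite (convDr c1 ch cN s0) (convZr (-1) c1 ch' s0) (e s s0).
  by rewrite mulN1r subrr.
have := conv1_eq0 (Cm1D ch cN) d0 t0.
by rewrite mulN1r => /eqP; rewrite subr_eq0 => /eqP.
Qed.

Lemma cancellable_eq f g : eq_pos f g -> cancellable f -> cancellable g.
Proof.
move=> fg cf h h' ch ch' e; apply: cf => //.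
apply: eq_pos_trans (eq_convl _ fg) _.
exact: eq_pos_trans e (eq_convl _ (eq_pos_sym fg)).
Qed.

(** Convolving f * h = f * h' with g reduces to the known cancellation. This handles kappa as a
    divisor of 1 and the numerator of S_kappa - lambda as a divisor of kappa^3. *)
Lemma cancellable_factor f g : Cm1 f -> Cm1 g -> cancellable (conv g f) -> cancellable f.
Proof.
move=> cf cg cgf h h' ch ch' e; apply: cgf => //.
apply: eq_pos_trans (eq_pos_sym (convA cg cf ch)) _.
by apply: eq_pos_trans (eq_convr _ e) _; exact: convA.
Qed.

Lemma cancellable_conv f g : Cm1 f -> Cm1 g -> cancellable f -> cancellable g ->
  cancellable (conv f g).
Proof.
move=> cf cg kf kg h h' ch ch' e; apply: (kg) => //; apply: kf; try exact: Cm1_conv.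
apply: eq_pos_trans (convA cf cg ch) _.
exact: eq_pos_trans e (eq_pos_sym (convA cf cg ch')).
Qed.

(** Otherwise f * 1 = f * 0 would give 1 = 0. *)
Lemma cancellable_neq0 f : cancellable f -> ~ eq_pos f (fun=> 0).
Proof.
move=> cf f0; have := cf _ _ (Cm1_cst 1) (Cm1_cst 0) => /(_ _ 1 ltr01) h.
suff /h /eqP : eq_pos (conv f (fun=> 1)) (conv f (fun=> 0)) by rewrite oner_eq0.
apply: eq_pos_trans (eq_convl _ f0) _; apply: eq_pos_trans (conv0l _) _.
exact: eq_pos_sym (eq_pos_trans (eq_convl _ f0) (conv0l _)).
Qed.

(** Multiplied by b2, the claim follows from b2 a1 c2 = b1 a2 c2 = b1 c2 a2 = b2 c1 a2; cancelling
    b2 is the one step beyond commutative algebra. *)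
Lemma frac_equiv_trans a b c : Cm1 a.1 -> Cm1 a.2 -> Cm1 b.1 -> Cm1 b.2 ->
  Cm1 c.1 -> Cm1 c.2 -> cancellable b.2 ->
  frac_equiv a b -> frac_equiv b c -> frac_equiv a c.
Proof.
move=> ca1 ca2 cb1 cb2 cc1 cc2 kb ab bc; apply: kb; try exact: Cm1_conv.
apply: eq_pos_trans (convA cb2 ca1 cc2) _.
apply: eq_pos_trans (eq_convl _ (convC cb2 ca1)) _.
apply: eq_pos_trans (eq_convl _ ab) _.
apply: eq_pos_trans (convAC cb1 ca2 cc2) _.
apply: eq_pos_trans (eq_convl _ bc) _.
apply: eq_pos_trans (eq_convl _ (convC cc1 cb2)) _.
exact: eq_pos_sym (convA cb2 cc1 ca2).
Qed.

(** The two inclusions pass through a and through b respectively, hence a condition on each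
    denominator. *)
Lemma eq_quot a b : Cm1 a.1 -> Cm1 a.2 -> Cm1 b.1 -> Cm1 b.2 ->
  cancellable a.2 -> cancellable b.2 -> frac_equiv a b -> quot a = quot b.
Proof.
move=> ca1 ca2 cb1 cb2 ka kb ab; apply/seteqP; split=> c [fc hc]; split=> //.
  by have [cc1 cc2 _] := fc; apply: frac_equiv_trans (eq_pos_sym ab) hc.
by have [cc1 cc2 _] := fc; apply: frac_equiv_trans ab hc.
Qed.

End Quotients.

Theorem theorem4p5 (R : realType) (kappa : cfun R) (lambda : R[i])
    (hkappa : sonine kappa) :
  let l := lser kappa lambda in
  let I := frac_one kappa in
  let e := frac_sub (frac_S kappa) (frac_scale lambda I) in
  [/\ (forall t : R, 0 < t -> cvgn (lpartial kappa lambda t)) /\ Cm1 l,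
      [/\ is_frac e, is_frac (frac_inv e) & is_frac (frac_embed kappa l)],
      quot (frac_mul e (frac_embed kappa l)) = quot I &
      quot (frac_inv e) = quot (frac_embed kappa l)].
Proof.
move=> l I e.
have Cm10_Cm1 f : Cm10 f -> Cm1 f by move=> [p /andP[p0 _] pf]; exists p.
have [/Cm10_Cm1 ck [k /Cm10_Cm1 ck' kk]] := hkappa.
have [cvl cl lE] := lser_resolvent lambda ck; rewrite -/l in cl lE.
have kkappa : cancellable kappa.
  apply: (cancellable_factor ck ck'); apply: cancellable_eq (@cancellable_one R).
  exact: eq_pos_sym (eq_pos_trans (convC ck' ck) kk).
pose k2 := conv kappa kappa; have ck2 : Cm1 k2 by exact: Cm1_conv.
pose m : cfun R := fun t => lambda * kappa t; have cm : Cm1 m by exact: Cm1Z.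
(* By computation [e.2] is k2 * kappa = kappa^3 and [e.1] is k2 + (-m) * k2. *)
have ce2 : Cm1 e.2 by exact: Cm1_conv.
have cNm := Cm1Z (-1) cm.
have cmk := Cm1_conv cNm ck2.
have ce1 : Cm1 e.1 by exact: Cm1D.
have ke2 : cancellable e.2 by apply: cancellable_conv => //; exact: cancellable_conv.
(* Convolving the resolvent equation l = kappa + m * l with k2 gives k2 * l = kappa^3 + k2 * m * l,
   whose last term is removed by the second summand of [e.1]. *)
have e1l : eq_pos (conv e.1 l) e.2.
  move=> t t0.
  have h1 : conv e.1 l t = conv k2 l t + conv (conv (fun t => -1 * m t) k2) l t.
    exact: (convDl ck2 cmk cl t0).
  have h2 : conv k2 l t = e.2 t + conv k2 (conv m l) t.
    rewrite (eq_convr k2 lE t0); exact: (convDr ck2 ck (Cm1_conv cm cl) t0).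
  have h3 : conv (conv (fun t => -1 * m t) k2) l t = - conv k2 (conv m l) t.
    rewrite (eq_convl l (convZl (-1) cm ck2) t0) (convZl _ (Cm1_conv cm ck2) cl t0).
    rewrite mulN1r (eq_convl l (convC cm ck2) t0); congr (- _).
    by rewrite (convA ck2 cm cl t0).
  by rewrite h1 h2 h3 addrK.
have ke1 : cancellable e.1.
  apply: (cancellable_factor ce1 cl).
  exact: cancellable_eq (eq_pos_trans (eq_pos_sym e1l) (convC ce1 cl)) ke2.
have clk : Cm1 (conv l kappa) by exact: Cm1_conv.
(* The embedding represents l by l * kappa over kappa, so [e1l] is multiplied by kappa; both
   equalities of classes are read off from this identity. *)
have e1lk : eq_pos (conv e.1 (conv l kappa)) (conv e.2 kappa).
  exact: eq_pos_trans (convA ce1 cl ck) (eq_convl _ e1l).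
split.
- by [].
- split; split => //; exact: cancellable_neq0.
- apply: (@eq_quot _ (frac_mul e (frac_embed kappa l)) I (Cm1_conv ce1 clk)
    (Cm1_conv ce2 ck) ck ck (cancellable_conv ce2 ck ke2 kkappa) kkappa).
  apply: eq_pos_trans (eq_convl kappa e1lk) _.
  exact: (convC (Cm1_conv ce2 ck) ck).
- apply: (@eq_quot _ (frac_inv e) (frac_embed kappa l) ce2 ce1 clk ck ke1 kkappa).
  exact: eq_pos_trans (eq_pos_sym e1lk) (convC ce1 clk).
Qed.
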